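(* Let $d\ge2$ and $n\ge0$ be integers and let $p$ be real with $p>2n+d$. Then every $v\in\mathcal V_n(\mathbb V_0^{d+1},w_{p,-1})$ satisfies, for $t>0$, the differential equation $$\left[t(1+t)\partial_t^2+\big(d-1+(-p+d+1)t\big)\partial_t+t^{-1}\Delta_0^{(x)}\right]v=n(n-p+d)\,v,$$ where $\Delta_0^{(x)}$ is the Laplace–Beltrami operator on $\mathbb S^{d-1}$ acting on the spherical variable.
   Context: Surface of the cone: $\mathbb V_0^{d+1}=\{(x,t):\|x\|=t,\ x\in\mathbb R^d,\ 0\le t<\infty\}$, with measure given by $\int_{\mathbb V_0^{d+1}}f\,d\sigma(x,t)=\int_0^\infty t^{d-1}\int_{\mathbb S^{d-1}}f(t\xi,t)\,d\sigma(\xi)\,dt$. Weight $w_{p,-1}(t)=t^{-1}(1+t)^{1-p}$ and inner product (up to a positive normalizing constant) $\langle f,g\rangle=\int_{\mathbb V_0^{d+1}}f(x,t)g(x,t)w_{p,-1}(t)\,d\sigma(x,t)$ on polynomials in $(x,t)$ modulo the ideal generated by $\|x\|^2-t^2$ (i.e. restrictions of polynomials to $\mathbb V_0^{d+1}$). $\mathcal V_n(\mathbb V_0^{d+1},w_{p,-1})$ is the space of (classes of) polynomials of degree at most $n$ orthogonal to all polynomials of degree less than $n$. The equation is understood in the coordinates $(\xi,t)$ with $x=t\xi$, $\xi\in\mathbb S^{d-1}$, $t>0$: $v$ is viewed as the function $(\xi,t)\mapsto v(t\xi,t)$, $\partial_t$ is the derivative in $t$ with $\xi$ fixed, and $\Delta_0^{(x)}$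 acts on the variable $\xi\in\mathbb S^{d-1}$ (so that $\Delta_0Y=-m(m+d-2)Y$ for spherical harmonics $Y$ of degree $m$). *)

(* Defs.v *)
From HB Require Import structures.
From mathcomp Require Import all_boot all_order all_algebra.
From mathcomp Require Import all_classical all_reals all_analysis.
(* Imported without its notations, which clash with those of the analysis
   library. *)
From mathcomp Require Import -(notations) mpoly.

Set Implicit Arguments.
Unset Strict Implicit.
Unset Printing Implicit Defensive.

Import Order.TTheory GRing.Theory Num.Theory.
Import numFieldNormedType.Exports.

Local Open Scope classical_set_scope.
Local Open Scope ring_scope.

Section SurfaceOfCone.
Context {R : realType}.

(* The norm `|x| that the library puts on 'rV[R]_d is the sup norm. *)
Definition enorm (d : nat) (x : 'rV[R]_d) : R :=
  Num.sqrt (\sum_(i < d) x 0 i ^+ 2).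

Definition sphere (d : nat) : set 'rV[R]_d := [set xi | enorm xi = 1].

Definition cone_surface (d : nat) : set ('rV[R]_d * R) :=
  [set z | enorm z.1 = z.2 /\ 0 <= z.2].

(* Integral over S^(d-1) in R^d against the (unnormalized) surface measure, in
   spherical coordinates: S^0 = {1, -1} carries the counting measure, and
     int_(S^(d+1)) f dsigma
       = int_0^pi (sin a)^d int_(S^d) f(cos a, sin a * eta) dsigma(eta) da. *)
Fixpoint sphere_integral (d : nat) : ('rV[R]_d -> R) -> R :=
  match d return ('rV[R]_d -> R) -> R with
  | 0 => fun _ => 0
  | d1.+1 =>
    match d1 return (('rV[R]_d1 -> R) -> R) -> ('rV[R]_d1.+1 -> R) -> R with
    | 0 => fun _ f => f (const_mx 1) + f (const_mx (-1))
    | d2.+1 => fun sphere_integral_d1 f =>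
        \int[lebesgue_measure]_(a in `[0, pi])
          (sin a ^+ d2 *
           sphere_integral_d1 (fun eta : 'rV[R]_d2.+1 =>
             f (row_mx (const_mx (cos a) : 'rV[R]_1) (sin a *: eta))))
    end (@sphere_integral d1)
  end.

Definition cone_integral (d : nat) (f : 'rV[R]_d * R -> R) : R :=
  \int[lebesgue_measure]_(t in `]0, +oo[)
    (t ^+ d.-1 * sphere_integral (fun xi : 'rV[R]_d => f (t *: xi, t))).

Definition cone_weight (p t : R) : R := t^-1 * (1 + t) `^ (1 - p).

(* Only meaningful when the integral converges: the library's real-valued
   integral is total. For f of degree n and g of degree less than n this
   is guaranteed by 2 n + d < p. *)
Definition cone_inner (d : nat) (p : R) (f g : 'rV[R]_d * R -> R) : R :=
  cone_integral (fun z => f z * g z * cone_weight p z.2).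

(* Functions whose restriction to the cone is that of a polynomial in (x, t) of
   degree < m: `mmeasure mdeg P` is `msize P`, i.e. 1 + deg P (0 for P = 0).
   Classes of polynomials modulo |x|^2 - t^2 are represented by such
   functions; their values off the cone are arbitrary and never used. *)
Definition cone_poly (d m : nat) : set ('rV[R]_d * R -> R) :=
  [set f | exists2 P : mpoly (d + 1) R, (mmeasure mdeg P <= m)%N &
    forall z, cone_surface z ->
      f z = meval (row_mx z.1 (const_mx z.2 : 'rV[R]_1) 0) P].

Definition cone_orthopoly (d : nat) (p : R) (n : nat) :
    set ('rV[R]_d * R -> R) :=
  [set v | cone_poly n.+1 v /\ forall q, cone_poly n q -> cone_inner p v q = 0].

Definition laplacian (d : nat) (f : 'rV[R]_d -> R) (x : 'rV[R]_d) : R :=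
  \sum_(i < d) 'D_(delta_mx 0 i) ('D_(delta_mx 0 i) f) x.

(* On the sphere, the Laplace-Beltrami operator is the Euclidean Laplacian of
   the extension that is homogeneous of degree 0. *)
Definition laplace_beltrami (d : nat) (g : 'rV[R]_d -> R) (xi : 'rV[R]_d) : R :=
  laplacian (fun y => g ((enorm y)^-1 *: y)) xi.

End SurfaceOfCone.

(* Main.v *)
(* On a monomial [x ^ a * t ^ k] of degree [N = |a| + k] the operator produces
   [N (N + d - p)] times the monomial plus terms of degree [N - 1]: the apparent
   pole [t^-1] cancels against [|x|^2 = t^2].  Hence [L - n (n - p + d)] sends
   polynomials of degree [<= n] to polynomials of degree [< n], without any
   decomposition into spherical harmonics.  It is also self-adjoint for the inner
   product: integration by parts is encoded in recurrences for the moments, namely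
   [(a_i + 1) M a = (|a| + d) M (a + 2 e_i)] on the sphere and
   [(m + d - 1) B m = (p - m - d - 1) B (m + 1)] on the half-line.  So for [v] in
   the orthogonal space, [w = (L - n (n - p + d)) v] has degree [< n] and
   [<w, w> = <v, (L - n (n - p + d)) w> = 0], which forces [w = 0] on the cone. *)

Require Import Defs.
From HB Require Import structures.
From mathcomp Require Import all_boot all_order all_algebra.
From mathcomp Require Import all_classical all_reals all_analysis.
From mathcomp Require Import measurable_realfun.
From mathcomp Require Import ring lra zify.
From mathcomp Require Import -(notations) mpoly.

Set Implicit Arguments.
Unset Strict Implicit.
Unset Printing Implicit Defensive.

Import Order.TTheory GRing.Theory Num.Theory.
Import numFieldNormedType.Exports.

Local Open Scope classical_set_scope.
Local Open Scope ring_scope.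

(** * Trigonometric moments *)

Section Integrals.
Context {R : realType}.
Notation mu := (@lebesgue_measure R).

(** The pole cancels as follows. Let m = |a|. At order t^(N-1) the t-derivatives contribute N (N + d
    - 2). The spherical part contributes - m (m + d - 2) and the Euclidean Laplacian of x^a, because
    on the sphere Delta_0 x^a = Delta x^a - m (m + d - 2) x^a. The two scalars add up to k (2 m + k
    + d - 2), whose factor k makes t^(k-1) legitimate, and Delta x^a, of degree m - 2, comes with
    t^(k+1).

    A function on the cone has many polynomial representatives, so the operator acts formally on a
    list of monomials chosen once for v. Conclusions are drawn only from integrals and values on the
    cone, which are the same for all representatives.

    The integral being a total function, linearity and integration by parts require convergence. A
    product of total degree N behaves like t^(N+d-1-p) at infinity, so the condition is N + d < p.
    All pairings in the argument have total degree at most 2 n, whence p > 2 n + d. *)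

Lemma Rintegral_sum (D : set (measurableTypeR R)) (I : eqType) (r : seq I) (f : I -> R -> R) :
  measurable D ->
  {in r, forall i, mu.-integrable D (EFin \o f i)} ->
  mu.-integrable D (EFin \o (fun x => \sum_(i <- r) f i x)) /\
  \int[mu]_(x in D) (\sum_(i <- r) f i x)
    = \sum_(i <- r) \int[mu]_(x in D) f i x.
Proof.
move=> mD; elim: r => [|i r IH] fi.
  split.
    by under [_ \o _]eq_fun do rewrite /= big_nil; exact: integrable0.
  under eq_Rintegral do rewrite big_nil.
  by rewrite big_nil Rintegral_cst// mul0r.
have [|ir er] := IH; first by move=> j jr; apply: fi; rewrite in_cons jr orbT.
have ii := fi i (mem_head _ _); split.
  under [_ \o _]eq_fun do rewrite /= big_cons EFinD.
  exact: integrableD.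
under eq_Rintegral do rewrite big_cons.
by rewrite big_cons RintegralD// er.
Qed.

Lemma open_Rintegral_eq0 (U : set R) (g : R -> R) :
  open U -> {in U, continuous g} -> (forall x, U x -> 0 <= g x) ->
  mu.-integrable U (EFin \o g) -> \int[mu]_(x in U) g x = 0 ->
  forall x, U x -> g x = 0.
Proof.
move=> oU cg g0 ig ig0 x Ux.
have mU : measurable (U : set (measurableTypeR R)) by exact: open_measurable.
have ig0E : (\int[mu]_(x in U) `|(EFin \o g) x| = 0)%E.
  rewrite (_ : integral _ _ _ = \int[mu]_(x in U) (EFin \o g) x)%E; last first.
    by apply: eq_integral => y /set_mem Uy; rewrite gee0_abs// lee_fin g0.
  have fi := integrable_fin_num mU ig.
  by rewrite -(fineK fi) -[fine _]/(Rintegral mu U g) ig0.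
have /(ae_eq_integral_abs _ mU) := measurable_int _ ig.
move=> /(_ mu) [/(_ ig0E) + _] => -[A [mA A0 sA]].
apply: contrapT => /eqP gx.
(* Vanishing almost everywhere becomes vanishing everywhere: by continuity a nonzero value persists
   on a ball, whose positive measure does not fit in the null set [A]. *)
have : \forall y \near x, U y /\ g y != 0.
  near=> y; split; first by near: y; exact: open_nbhs_nbhs.
  near: y; have /(_ x) := cg; rewrite inE => /(_ Ux) cgx.
  exact: cvgr_neq0 cgx gx.
move=> [e /= e0 xe].
have : (0 < mu (ball x e))%E by rewrite lebesgue_measure_ball ?ltW// lte_fin; lra.
apply/negP; rewrite -leNgt -A0; apply: le_measure; rewrite ?inE//=.
  exact: measurable_ball.
move=> y /xe [Uy gy]; apply: sA => /= /(_ Uy) [] gy0.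
by rewrite gy0 eqxx in gy.
Unshelve. all: by end_near. Qed.

Definition trig_moment (a b : nat) : R :=
  \int[mu]_(x in `[0, pi]) (cos x ^+ a * sin x ^+ b).

Lemma continuous_integrable_itv (a b : R) (f : R -> R) :
  continuous f -> mu.-integrable `[a, b] (EFin \o f).
Proof.
move=> cf; apply: continuous_compact_integrable; first exact: segment_compact.
exact: continuous_subspaceT.
Qed.

Lemma continuous_trig (a b : nat) :
  continuous (fun x : R => cos x ^+ a * sin x ^+ b).
Proof.
move=> x; apply: cvgM.
  apply: (@continuous_comp _ _ _ (@cos R) (fun y : R => y ^+ a)).
    exact: continuous_cos.
  exact: exprn_continuous.
apply: (@continuous_comp _ _ _ (@sin R) (fun y : R => y ^+ b)).
    exact: continuous_sin.
  exact: exprn_continuous.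
Qed.

(** Integrates the derivative of cos^a sin^(b+1) over [0, pi]; the positive power of the sine kills
    both boundary values. For [a = 0] the truncated [a.-1] is masked by the factor [a%:R]. *)
Lemma trig_moment_step (a b : nat) :
  a%:R * trig_moment a.-1 b.+2 = b.+1%:R * trig_moment a.+1 b.
Proof.
pose F (x : R) := cos x ^+ a * sin x ^+ b.+1.
pose f (x : R) := b.+1%:R * (cos x ^+ a.+1 * sin x ^+ b)
  - a%:R * (cos x ^+ a.-1 * sin x ^+ b.+2).
have cf : continuous f.
  move=> x; apply: cvgB; apply: cvgM; (try exact: cvg_cst);
    exact: continuous_trig.
have dF (x : R) : is_derive x 1 F (f x).
  have -> : F = cos ^+ a * sin ^+ b.+1 by rewrite !exprfctE.
  apply: is_derive_eq; rewrite /f /GRing.scale/= !exprfctE.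
  case: (a) => [|a']; rewrite /= ?exprS; ring.
have cF : continuous F by exact: continuous_trig.
have Fab : derivable_oo_LRcontinuous F 0 pi.
  split; first by move=> x _; exact: (@ex_derive _ _ _ _ _ _ _ (dF x)).
    exact: cvg_at_right_filter (cF 0).
  exact: cvg_at_left_filter (cF pi).
have F'f : {in `]0, pi[, derive1 F =1 f}.
  by move=> x _; rewrite derive1E; exact: derive_val.
have := continuous_FTC2 (pi_gt0 R) (continuous_subspaceT cf) Fab F'f.
rewrite /F sin0 sinpi !expr0n !mulr0 subee// => /(congr1 fine) /=.
rewrite -[LHS]/(\int[mu]_(x in `[0, pi]) f x) /f RintegralB//; last 2 first.
- by apply: continuous_integrable_itv => x; apply: cvgM;
    [exact: cvg_cst|exact: continuous_trig].
- by apply: continuous_integrable_itv => x; apply: cvgM;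
    [exact: cvg_cst|exact: continuous_trig].
rewrite !RintegralZl//; last 2 first.
- by apply: continuous_integrable_itv; exact: continuous_trig.
- by apply: continuous_integrable_itv; exact: continuous_trig.
by move/eqP; rewrite subr_eq0 => /eqP.
Qed.

Lemma trig_moment_pythagoras (a b : nat) :
  trig_moment a.+2 b + trig_moment a b.+2 = trig_moment a b.
Proof.
rewrite /trig_moment -RintegralD//; last 2 first.
- by apply: continuous_integrable_itv; exact: continuous_trig.
- by apply: continuous_integrable_itv; exact: continuous_trig.
apply: eq_Rintegral => x _; rewrite -[RHS]mulr1 -(cos2Dsin2 x).
by rewrite -(addn2 a) -(addn2 b) !exprD; ring.
Qed.

Lemma trig_moment_odd (a b : nat) : odd a -> trig_moment a b = 0.
Proof.
elim/ltn_ind: a b => -[|a] IH b //= oa.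
have := trig_moment_step a b.
case: a oa IH => [|a] oa IH.
  rewrite mul0r => /esym/eqP; rewrite mulf_eq0 pnatr_eq0 => /eqP//.
rewrite IH ?mulr0//; last by move: oa; rewrite /= negbK.
by move=> /esym/eqP; rewrite mulf_eq0 pnatr_eq0 => /eqP.
Qed.

(** The Pythagorean relation and [trig_moment_step] at [a.+1] are two linear equations for the two
    raised moments; this lemma and the next one solve them. *)
Lemma trig_moment_cos2 (a b : nat) :
  (a + b + 2)%:R * trig_moment a.+2 b = a.+1%:R * trig_moment a b.
Proof.
rewrite -(trig_moment_pythagoras a b) mulrDr (trig_moment_step a.+1 b) -mulrDl.
by rewrite -natrD; congr (_%:R * _); lia.
Qed.

Lemma trig_moment_sin2 (a b : nat) :
  (a + b + 2)%:R * trig_moment a b.+2 = b.+1%:R * trig_moment a b.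
Proof.
rewrite -(trig_moment_pythagoras a b) mulrDr -(trig_moment_step a.+1 b) -mulrDl.
by rewrite -natrD; congr (_%:R * _); lia.
Qed.

End Integrals.

(** * Moments on the half-line *)

Section HalfLine.
Context {R : realType}.
Notation mu := (@lebesgue_measure R).

Lemma is_derive_shift_powR (s t : R) : 0 <= t ->
  is_derive t 1 (fun x : R => (1 + x) `^ s) (s * (1 + t) `^ (s - 1)).
Proof.
move=> t0; have t1 : 0 < 1 + t by lra.
have h : is_derive t 1 (fun x : R => 1 + x) 1.
  by rewrite -[X in is_derive _ _ _ X]add0r; exact: is_deriveD.
have := @is_derive1_comp R (fun x => x `^ s) (fun x => 1 + x) t _ _
  (@is_derive1_powR R s (1 + t) t1) h.
by rewrite mulr1.
Qed.

Lemma continuous_shift_powR (s t : R) : 0 <= t ->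
  {for t, continuous (fun x : R => (1 + x) `^ s)}.
Proof.
move=> t0; apply: differentiable_continuous; apply/derivable1_diffP.
by have [] := is_derive_shift_powR s t0.
Qed.

Lemma cvgy_shift_powR (s : R) : s < 0 -> (1 + t) `^ s @[t --> +oo%R] --> 0.
Proof.
move=> s0; apply/cvgrPdist_le => e e0; near=> t.
have t1 : 0 < 1 + t.
  have : 0 <= t by near: t; exact: nbhs_pinfty_ge.
  lra.
rewrite sub0r normrN ger0_norm ?powR_ge0//.
(* The threshold e^(1/s) is the point where x^s equals e. *)
have h : e `^ (s^-1) <= 1 + t.
  have : e `^ (s^-1) <= t by near: t; exact: nbhs_pinfty_ge.
  lra.
have e1 : 0 < e `^ (s^-1) by exact: powR_gt0.
have -> : e = ((e `^ s^-1) `^ (- s))^-1.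
  by rewrite -powRN opprK -powRrM mulVf ?lt_eqF// powRr1// ltW.
have -> : (1 + t) `^ s = ((1 + t) `^ (- s))^-1 by rewrite -powRN opprK.
rewrite lef_pV2 ?posrE ?powR_gt0//.
by apply: ge0_ler_powR; rewrite ?nnegrE ?oppr_ge0 ?(ltW s0) ?(ltW t1) ?(ltW e1).
Unshelve. all: by end_near. Qed.

Lemma measurable_half_line (D : set R) (f : R -> R) :
  D `<=` `[0, +oo[ -> measurable (D : set (measurableTypeR R)) ->
  (forall t : R, 0 <= t -> {for t, continuous f}) ->
  measurable_fun (D : set (measurableTypeR R)) (EFin \o f).
Proof.
move=> D0 mD cf; apply/measurable_EFinP.
apply: subspace_continuous_measurable_fun => //.
apply: continuous_in_subspaceT => t /set_mem /D0.
by rewrite /= in_itv/= andbT => /cf.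
Qed.

(* The signed version of the fundamental theorem on the half-line: adding a
   large multiple of an integrable power makes the integrand nonnegative. *)
Lemma dominated_FTCy (f F : R -> R) (r C : R) : 1 < r ->
  (forall t : R, 0 <= t -> {for t, continuous f}) ->
  (forall t : R, 0 <= t -> is_derive t 1 F (f t)) ->
  (forall t : R, 0 <= t -> `|f t| <= C * (1 + t) `^ (- r)) ->
  F t @[t --> +oo%R] --> 0 ->
  mu.-integrable `]0, +oo[ (EFin \o f) /\
  \int[mu]_(t in `]0, +oo[) f t = - F 0.
Proof.
move=> r1 cf dF fC F0.
have C0 : 0 <= C.
  have := le_trans (normr_ge0 _) (fC 0 (lexx 0)).
  by rewrite addr0 powR1 mulr1.
pose g (t : R) := (1 + t) `^ (- r).
pose G (t : R) := (1 - r)^-1 * (1 + t) `^ (1 - r).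
have cg (t : R) : 0 <= t -> {for t, continuous g} by exact: continuous_shift_powR.
have dG (t : R) : 0 <= t -> is_derive t 1 G (g t).
  move=> t0; have h := is_derive_shift_powR (1 - r) t0.
  have : is_derive t 1 ((1 - r)^-1 \*o (fun x : R => (1 + x) `^ (1 - r)))
     ((1 - r)^-1 *: ((1 - r) * (1 + t) `^ (1 - r - 1))) by exact: is_deriveZ.
  rewrite /GRing.scale/= mulrA mulVf ?mul1r; last by rewrite subr_eq0 lt_eqF.
  by rewrite addrAC subrr sub0r.
have G0 : G t @[t --> +oo%R] --> 0.
  rewrite -(mulr0 (1 - r)^-1); apply: cvgMr.
  by apply: cvgy_shift_powR; lra.
have wc (h : R -> R) : (forall t : R, 0 <= t -> {for t, continuous h}) ->
    {within `[0, +oo[, continuous h}.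
  move=> ch; apply: continuous_in_subspaceT => t.
  by rewrite inE/= in_itv/= andbT => /ch.
have FTC (h H : R -> R) : (forall t : R, 0 <= t -> {for t, continuous h}) ->
    (forall t : R, 0 <= t -> is_derive t 1 H (h t)) ->
    (forall t : R, 0 <= t -> 0 <= h t) -> H t @[t --> +oo%R] --> 0 ->
    (\int[mu]_(t in `[0%R, +oo[) (h t)%:E = (- H 0)%:E)%E.
  move=> ch dH h0 H0; rewrite (@ge0_continuous_FTC2y _ h H 0 0)//.
  - by rewrite sub0e.
  - exact: wc.
  - by move=> t /ltW/dH [].
  - apply: cvg_at_right_filter; apply: differentiable_continuous.
    by apply/derivable1_diffP; have [] := dH 0 (lexx 0).
  - move=> t; rewrite in_itv/= andbT => /ltW t0.
    by have ? := dH t t0; rewrite derive1E derive_val.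
have g0 (t : R) : 0 <= g t by exact: powR_ge0.
have ig : mu.-integrable `[0, +oo[ (EFin \o g).
  apply/integrableP; split; first exact: measurable_half_line.
  rewrite (_ : integral _ _ _ = \int[mu]_(x in `[0%R, +oo[) (g x)%:E)%E.
    by rewrite (FTC _ _ cg dG) ?ltry.
  by apply: eq_integral => t _; rewrite gee0_abs// lee_fin.
have jf : mu.-integrable `[0, +oo[ (EFin \o f).
  apply: (@le_integrable _ _ _ mu _ _ _ (EFin \o (fun t => C * g t))) => //.
  - exact: measurable_half_line.
  - move=> t /=; rewrite in_itv/= andbT => t0; rewrite lee_fin.
    by rewrite [leRHS]ger0_norm ?mulr_ge0// fC.
  - rewrite (_ : _ \o _ = (fun t => C%:E * (g t)%:E)%E); last first.
      by apply/funext => t; rewrite /= EFinM.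
    exact: integrableZl.
have sub : (`]0, +oo[ : set R) `<=` `[0, +oo[.
  by move=> t /=; rewrite !in_itv/= !andbT => /ltW.
have int0 : mu.-integrable `]0, +oo[ (EFin \o f).
  by apply: integrableS jf.
split=> //; rewrite Rintegral_itv_obnd_cbnd//.
have int_g : \int[mu]_(t in `[0, +oo[) g t = - G 0.
  by rewrite /Rintegral (FTC _ _ cg dG).
have iCg : mu.-integrable `[0, +oo[ (EFin \o (fun t => C * g t)).
  rewrite (_ : _ \o _ = (fun t => C%:E * (g t)%:E)%E); last first.
    by apply/funext => t; rewrite /= EFinM.
  exact: integrableZl.
have fCg : (\int[mu]_(t in `[0%R, +oo[) (f t + C * g t)%:E
    = (- (F 0 + C * G 0))%:E)%E.
  apply: (FTC _ (fun t => F t + C * G t)).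
  - move=> t t0; apply: cvgD; first exact: cf.
    by apply: cvgMr; exact: cg.
  - move=> t t0; apply: is_deriveD; first exact: dF.
    have ? := dG t t0; exact: is_deriveZ.
  - move=> t t0; have := fC t t0; rewrite ler_norml => /andP[+ _].
    by rewrite -/(g t); lra.
  - rewrite -(addr0 0); apply: cvgD => //.
    by rewrite -(mulr0 C); apply: cvgMr.
have : \int[mu]_(t in `[0, +oo[) (f t + C * g t) = - (F 0 + C * G 0).
  by rewrite /Rintegral fCg.
rewrite RintegralD// RintegralZl// int_g => /eqP.
by rewrite mulrN opprD (inj_eq (addIr _)) => /eqP.
Qed.

Definition half_line_moment (j : nat) (s : R) : R :=
  \int[mu]_(t in `]0, +oo[) (t ^+ j * (1 + t) `^ (- s)).

Lemma shift_powR_bound (j : nat) (s t : R) : 0 <= t ->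
  t ^+ j * (1 + t) `^ (- s) <= (1 + t) `^ (j%:R - s).
Proof.
move=> t0; have t1 : 0 < 1 + t by lra.
rewrite powRD; last by apply/implyP => _; rewrite gt_eqF.
rewrite powR_mulrn ?(ltW t1)// ler_wpM2r ?powR_ge0//.
by apply: lerXn2r; rewrite ?nnegrE; lra.
Qed.

Lemma continuous_half_line (j : nat) (s t : R) : 0 <= t ->
  {for t, continuous (fun x : R => x ^+ j * (1 + x) `^ (- s))}.
Proof.
move=> t0; apply: cvgM; last exact: continuous_shift_powR.
exact: exprn_continuous.
Qed.

(** Since t^j <= (1 + t)^j, the integrand is dominated by the pure power (1 + t)^(j - s), which has
    an explicit antiderivative. *)
Lemma half_line_integrable (j : nat) (s : R) : j.+1%:R < s ->
  mu.-integrable `]0, +oo[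
    (EFin \o (fun t : R => t ^+ j * (1 + t) `^ (- s))).
Proof.
move=> js; have js1 : j%:R + 1 < s by rewrite -natr1 in js.
have [ig _] : mu.-integrable `]0, +oo[
    (EFin \o (fun t : R => (1 + t) `^ (- (s - j%:R)))) /\
    \int[mu]_(t in `]0, +oo[) ((1 + t) `^ (- (s - j%:R))) =
    - ((1 - (s - j%:R))^-1 * (1 + 0) `^ (1 - (s - j%:R))).
  apply: (@dominated_FTCy _ (fun t => (1 - (s - j%:R))^-1 * (1 + t) `^ (1 - (s - j%:R)))
    (s - j%:R) 1); first lra.
  - by move=> t; exact: continuous_shift_powR.
  - move=> t t0; have h := is_derive_shift_powR (1 - (s - j%:R)) t0.
    have := is_deriveZ (1 - (s - j%:R))^-1 h.
    rewrite /GRing.scale/= mulrA mulVf ?mul1r.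
      by rewrite addrAC subrr sub0r.
    by rewrite lt_eqF//; lra.
  - by move=> t t0; rewrite mul1r ger0_norm ?powR_ge0.
  - rewrite -[X in _ --> X](mulr0 (1 - (s - j%:R))^-1); apply: cvgMr.
    by apply: cvgy_shift_powR; lra.
apply: le_integrable ig => //.
- apply: measurable_half_line => //; first by move=> t /=; rewrite !in_itv/= !andbT => /ltW.
  by move=> t; exact: continuous_half_line.
- move=> t /=; rewrite in_itv/= andbT => /ltW t0; rewrite lee_fin.
  rewrite !ger0_norm ?powR_ge0 ?mulr_ge0 ?exprn_ge0 ?powR_ge0//.
  by rewrite opprB; exact: shift_powR_bound.
Qed.

(** Integrates the derivative of t^(j+1) (1 + t)^(1-s), which vanishes at 0 and, because j + 2 < s,
    at infinity. *)
Lemma half_line_moment_step (j : nat) (s : R) : j.+2%:R < s ->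
  j.+1%:R * half_line_moment j s = (s - j.+2%:R) * half_line_moment j.+1 s.
Proof.
move=> js; have js1 : j%:R + 2 < s by move: js; rewrite -addn2 natrD.
pose f (t : R) := j.+1%:R * (t ^+ j * (1 + t) `^ (- s)) -
  (s - j.+2%:R) * (t ^+ j.+1 * (1 + t) `^ (- s)).
pose F (t : R) := t ^+ j.+1 * (1 + t) `^ (1 - s).
(* Both terms of [f] are bounded by their coefficient times (1 + t)^(j+1-s), and the coefficients j
   + 1 and s - (j + 2) add up to at most j + 1 + s. *)
have [] := @dominated_FTCy f F (s - j.+1%:R) (j.+1%:R + s).
- by rewrite -natr1; lra.
- move=> t t0; apply: cvgB; apply: cvgMr; exact: continuous_half_line.
- move=> t t0; have ? := is_derive_shift_powR (1 - s) t0.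
  have -> : F = (@id R ^+ j.+1) * (fun x : R => (1 + x) `^ (1 - s)).
    by rewrite exprfctE.
  apply: is_derive_eq; rewrite /f exprfctE /GRing.scale/= mulr1.
  have -> : (1 + t) `^ (1 - s) = (1 + t) * (1 + t) `^ (- s).
    by rewrite powRD ?powRr1//; [lra|apply/implyP => _; rewrite gt_eqF//; lra].
  have -> : 1 - s - 1 = - s by ring.
  by rewrite -!natr1 exprS; ring.
- move=> t t0; have t1 : 0 < 1 + t by lra.
  apply: le_trans (ler_normB _ _) _; rewrite [leRHS]mulrDl opprB.
  apply: lerD => /=.
    rewrite ger0_norm ?mulr_ge0 ?exprn_ge0 ?powR_ge0// ler_wpM2l//.
    apply: le_trans (shift_powR_bound _ _ t0) _.
    by apply: ler_powR; [lra|rewrite -natr1; lra].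
  rewrite ger0_norm ?mulr_ge0 ?exprn_ge0 ?powR_ge0 ?subr_ge0 ?(ltW js)//.
  apply: ler_pM; rewrite ?mulr_ge0 ?exprn_ge0 ?powR_ge0 ?subr_ge0 ?(ltW js)//.
    by rewrite gerBl.
  exact: shift_powR_bound.
- apply: (@squeeze_cvgr _ _ _ _ (cst 0) (fun t => (1 + t) `^ (j.+1%:R + (1 - s)))).
  + near=> t; have t0 : 0 <= t by near: t; exact: nbhs_pinfty_ge.
    rewrite mulr_ge0 ?exprn_ge0 ?powR_ge0//=.
    by rewrite /F -[1 - s]opprK; exact: shift_powR_bound.
  + exact: cvg_cst.
  + by apply: cvgy_shift_powR; rewrite -natr1; lra.
have h1 : mu.-integrable `]0, +oo[ (EFin \o (fun t => t ^+ j * (1 + t) `^ (- s))).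
  by apply: half_line_integrable; rewrite -natr1; lra.
have h2 : mu.-integrable `]0, +oo[ (EFin \o (fun t => t ^+ j.+1 * (1 + t) `^ (- s))).
  by apply: half_line_integrable.
move=> _; rewrite /F expr0n mul0r oppr0 /f RintegralB//; last 2 first.
- exact: (integrableZl _ _ h1).
- exact: (integrableZl _ _ h2).
by rewrite !RintegralZl// => /eqP; rewrite subr_eq0 => /eqP.
Unshelve. all: by end_near. Qed.

End HalfLine.

(** * Moments on the sphere *)

Section SphereMoments.
Context {R : realType}.
Notation mu := (@lebesgue_measure R).

Definition mono (d : nat) (a : multinom d) (x : 'rV[R]_d) : R :=
  \prod_(i < d) x 0 i ^+ a i.

(** The splitting [1 + d] mirrors the [row_mx] in [sphere_integral], so that in spherical
    coordinates a monomial factors into a trigonometric one and a monomial on the smaller sphere. *)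
Definition mnm_behead (d : nat) (a : multinom (1 + d)) : multinom d :=
  Multinom (mktuple (fun j => a (rshift 1 j))).

Definition mnm_head (d : nat) (a : multinom (1 + d)) : nat :=
  a (lshift d ord0).

Definition bump2 (d : nat) (a : multinom d) (i : 'I_d) : multinom d :=
  mnm_add a (mnm_add (mnm1 i) (mnm1 i)).

Definition spherical_coord (d : nat) (x : R) (eta : 'rV[R]_d) : 'rV[R]_(1 + d) :=
  row_mx (const_mx (cos x) : 'rV[R]_1) (sin x *: eta).

Definition sphere_moment (d : nat) (a : multinom d) : R :=
  sphere_integral (mono a).

Lemma mnm_beheadE (d : nat) (a : multinom (1 + d)) j :
  mnm_behead a j = a (rshift 1 j).
Proof. exact: mnmE. Qed.

Lemma mdeg_behead (d : nat) (a : multinom (1 + d)) :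
  mdeg a = (mnm_head a + mdeg (mnm_behead a))%N.
Proof.
rewrite !mdegE big_split_ord/= big_ord1; congr (_ + _)%N.
by apply: eq_bigr => j _; rewrite mnm_beheadE.
Qed.

Lemma bump2E (d : nat) (a : multinom d) i j :
  bump2 a i j = (a j + (i == j).*2)%N.
Proof. by rewrite !mnmDE !mnm1E addnn. Qed.

Lemma mdeg_bump2 (d : nat) (a : multinom d) i : mdeg (bump2 a i) = (mdeg a).+2.
Proof. by rewrite !mdegD !mdeg1 addn2. Qed.

Lemma monoD (d : nat) (a b : multinom d) x :
  mono (mnm_add a b) x = mono a x * mono b x.
Proof. by rewrite -big_split; apply: eq_bigr => i _; rewrite mnmDE exprD. Qed.

Lemma mono_spherical_coord (d : nat) (a : multinom (1 + d)) x (eta : 'rV[R]_d) :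
  mono a (spherical_coord x eta) =
  cos x ^+ mnm_head a * sin x ^+ mdeg (mnm_behead a) * mono (mnm_behead a) eta.
Proof.
rewrite /mono big_split_ord/= big_ord1 row_mxEl mxE -mulrA; congr (_ * _).
rewrite mdegE -prodrXr -big_split/=; apply: eq_bigr => j _.
by rewrite row_mxEr mxE exprMn mnm_beheadE.
Qed.

Lemma sphereP (d : nat) (x : 'rV[R]_d) :
  sphere x <-> \sum_(i < d) x 0 i ^+ 2 = 1.
Proof.
have h0 : 0 <= \sum_(i < d) x 0 i ^+ 2 by apply: sumr_ge0 => i _; exact: sqr_ge0.
rewrite /sphere/= /enorm; split=> [h|->]; last by rewrite sqrtr1.
by rewrite -(sqr_sqrtr h0) h expr1n.
Qed.

Lemma sphere_spherical_coord (d : nat) (x : R) (eta : 'rV[R]_d) :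
  sphere eta -> sphere (spherical_coord x eta).
Proof.
move=> /sphereP eta1; apply/sphereP; rewrite big_split_ord/= big_ord1.
rewrite row_mxEl mxE -[RHS](cos2Dsin2 x); congr (_ + _).
under eq_bigr do rewrite row_mxEr mxE exprMn.
by rewrite -mulr_sumr eta1 mulr1.
Qed.

Lemma sphere_const1 (b : bool) : sphere (const_mx ((-1) ^+ b) : 'rV[R]_1).
Proof. by apply/sphereP; rewrite big_ord1 mxE sqrr_sign. Qed.

Lemma sphere_integralSS (d : nat) (f : 'rV[R]_d.+2 -> R) :
  sphere_integral f = \int[mu]_(x in `[0, pi])
    (sin x ^+ d * sphere_integral (fun eta : 'rV[R]_d.+1 =>
       f (spherical_coord x eta))).
Proof. by []. Qed.

Lemma sphere_integral1 (f : 'rV[R]_1 -> R) :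
  sphere_integral f = f (const_mx 1) + f (const_mx (-1)).
Proof. by []. Qed.

Lemma eq_sphere_integral (d : nat) (f g : 'rV[R]_d -> R) :
  (forall x, sphere x -> f x = g x) -> sphere_integral f = sphere_integral g.
Proof.
elim: d f g => [|[|d] IH] f g fg //.
  rewrite !sphere_integral1 (fg _ (sphere_const1 false)).
  by rewrite (fg _ (sphere_const1 true)).
rewrite !sphere_integralSS; apply: eq_Rintegral => x _; congr (_ * _).
by apply: IH => eta Seta; apply: fg; exact: sphere_spherical_coord.
Qed.

Lemma sphere_integral_ge0 (d : nat) (f : 'rV[R]_d -> R) :
  (forall x, sphere x -> 0 <= f x) -> 0 <= sphere_integral f.
Proof.
elim: d f => [|[|d] IH] f f0 //.
  rewrite sphere_integral1 addr_ge0//.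
    exact: f0 (sphere_const1 false).
  exact: f0 (sphere_const1 true).
rewrite sphere_integralSS; apply: Rintegral_ge0 => x.
rewrite /= in_itv/= => x0pi; rewrite mulr_ge0 ?exprn_ge0 ?sin_ge0_pi//.
by apply: IH => eta Seta; apply: f0; exact: sphere_spherical_coord.
Qed.

(** Linearity is stated for combinations of monomials because their slices are again such
    combinations, and each one-dimensional integrand is then continuous, hence integrable. *)
Lemma sphere_integral_sum (d : nat) (I : eqType) (r : seq I) (c : I -> R)
    (a : I -> multinom d) :
  sphere_integral (fun x => \sum_(i <- r) c i * mono (a i) x)
    = \sum_(i <- r) c i * sphere_moment (a i).
Proof.
elim: d I r c a => [|[|d] IH] I r c a.
- by rewrite [LHS]/= big1 // => i _; rewrite mulr0.
- rewrite sphere_integral1 -big_split/=; apply: eq_bigr => i _.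
  by rewrite /sphere_moment sphere_integral1 mulrDr.
have int (b : multinom (1 + d.+1)) (e : R) :
    mu.-integrable `[0, pi] (EFin \o (fun x =>
    e * (cos x ^+ mnm_head b * sin x ^+ (d + mdeg (mnm_behead b))))).
  apply: continuous_integrable_itv => x; apply: cvgMr.
  exact: continuous_trig.
have int1 (b : multinom (1 + d.+1)) : mu.-integrable `[0, pi] (EFin \o (fun x =>
    cos x ^+ mnm_head b * sin x ^+ (d + mdeg (mnm_behead b)))).
  by apply: continuous_integrable_itv; exact: continuous_trig.
have step (J : eqType) (s : seq J) (e : J -> R) (b : J -> multinom (1 + d.+1)) :
    sphere_integral (fun x : 'rV[R]_d.+2 => \sum_(i <- s) e i * mono (b i) x) =
    \sum_(i <- s) e i * (sphere_moment (mnm_behead (b i)) *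
      trig_moment (mnm_head (b i)) (d + mdeg (mnm_behead (b i)))).
  transitivity (\int[mu]_(x in `[0, pi]) \sum_(i <- s)
     ((e i * sphere_moment (mnm_behead (b i))) *
     (cos x ^+ mnm_head (b i) * sin x ^+ (d + mdeg (mnm_behead (b i)))))).
    rewrite sphere_integralSS; apply: eq_Rintegral => x _.
    under [X in sphere_integral X]eq_fun do under eq_bigr do
      rewrite mono_spherical_coord mulrA.
    rewrite IH mulr_sumr; apply: eq_bigr => i _; rewrite exprD; ring.
  rewrite (Rintegral_sum _ _).2//.
  by apply: eq_bigr => i _; rewrite RintegralZl// mulrA.
rewrite step; apply: eq_bigr => i _; congr (_ * _).
(* The singleton instance of [step] identifies the product of lower moments with
   [sphere_moment (a i)]. *)
have := step _ [:: i] (fun=> 1) a; rewrite big_seq1 mul1r => <-.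
by congr sphere_integral; apply/funext => x; rewrite big_seq1 mul1r.
Qed.

Lemma sphere_momentSS (d : nat) (a : multinom (1 + d.+1)) :
  @sphere_moment d.+2 a = sphere_moment (mnm_behead a) *
    trig_moment (mnm_head a) (d + mdeg (mnm_behead a)).
Proof.
rewrite /sphere_moment sphere_integralSS -RintegralZl//; last first.
  by apply: continuous_integrable_itv; exact: continuous_trig.
apply: eq_Rintegral => x _.
have := sphere_integral_sum [:: tt]
  (fun=> cos x ^+ mnm_head a * sin x ^+ mdeg (mnm_behead a))
  (fun=> mnm_behead a).
under [X in sphere_integral X]eq_fun do
  rewrite big_seq1 -mono_spherical_coord.
by rewrite big_seq1 => ->; rewrite exprD; rewrite /sphere_moment; ring.
Qed.

Lemma sphere_moment_odd (d : nat) (a : multinom d) i :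
  odd (a i) -> sphere_moment a = 0.
Proof.
elim: d a i => [|[|d] IH] a i.
- by case: i.
- rewrite ord1 => oa; rewrite /sphere_moment sphere_integral1 /mono !big_ord1.
  by rewrite !mxE expr1n -signr_odd oa subrr.
- case: (split_ordP (i : 'I_(1 + d.+1))) => j ->.
    by rewrite (ord1 j) sphere_momentSS => oa; rewrite trig_moment_odd ?mulr0.
  by rewrite -mnm_beheadE sphere_momentSS => oa; rewrite (IH _ j)// mul0r.
Qed.

(** Induction on the dimension. Raising the first exponent affects only the power of the cosine.
    Raising another one affects the lower moment and the power of the sine; the factor gained from
    [trig_moment_sin2] is exactly the one on the left of the induction hypothesis. *)
Lemma sphere_moment_bump (d : nat) (a : multinom d) i :
  (mdeg a + d)%:R * sphere_moment (bump2 a i) = (a i).+1%:R * sphere_moment a.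
Proof.
elim: d a i => [|[|d] IH] a i.
- by case: i.
- rewrite ord1 /sphere_moment !sphere_integral1 /mono !big_ord1 !mxE bump2E.
  by rewrite mdegE big_ord1 addn1 eqxx !exprD !expr1n sqrrN expr1n !mulr1.
- rewrite !sphere_momentSS (mdeg_behead (a : multinom (1 + d.+1))).
  case: (split_ordP (i : 'I_(1 + d.+1))) => j ->.
  + have -> : mnm_behead (bump2 (a : multinom (1 + d.+1)) (lshift d.+1 j))
      = mnm_behead a.
      by apply/mnmP => k; rewrite !mnm_beheadE bump2E eq_lrshift addn0.
    have -> : mnm_head (bump2 (a : multinom (1 + d.+1)) (lshift d.+1 j))
      = (mnm_head a).+2 by rewrite /mnm_head bump2E (ord1 j) eqxx addn2.
    have := trig_moment_cos2 (R := R) (mnm_head a) (d + mdeg (mnm_behead a)).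
    rewrite (ord1 j) -/(mnm_head a).
    have -> : (mnm_head a + (d + mdeg (mnm_behead a)) + 2 =
      mnm_head a + mdeg (mnm_behead a) + d.+2)%N by lia.
    by move=> e; rewrite mulrCA e mulrCA.
  + have -> : mnm_behead (bump2 (a : multinom (1 + d.+1)) (rshift 1 j))
      = bump2 (mnm_behead a) j.
      by apply/mnmP => k; rewrite !(mnm_beheadE, bump2E) eq_rshift.
    have -> : mnm_head (bump2 (a : multinom (1 + d.+1)) (rshift 1 j))
      = mnm_head a by rewrite /mnm_head bump2E eq_rlshift addn0.
    rewrite mdeg_bump2 !addnS.
    have := trig_moment_sin2 (R := R) (mnm_head a) (d + mdeg (mnm_behead a)).
    have := IH (mnm_behead a) j; rewrite -(mnm_beheadE (a : multinom (1 + d.+1))).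
    have -> : (mnm_head a + (d + mdeg (mnm_behead a)) + 2 =
      (mnm_head a + mdeg (mnm_behead a) + d).+2)%N by lia.
    rewrite (addnC (mdeg (mnm_behead a))) addSn => e1 e2.
    by rewrite mulrCA e2 mulrCA mulrA e1 mulrA.
Qed.

End SphereMoments.

(** * Green's identity and definiteness of the integral on the sphere *)

Section SpherePositivity.
Context {R : realType}.
Notation mu := (@lebesgue_measure R).

(** Exponent of the second partial derivative of x^a. Where the subtraction truncates, the
    coefficient a_i (a_i - 1) is zero. *)
Definition drop2 (d : nat) (a : multinom d) (i : 'I_d) : multinom d :=
  mnm_sub a (mnm_add (mnm1 i) (mnm1 i)).

Lemma drop2E (d : nat) (a : multinom d) i j :
  drop2 a i j = (a j - (i == j).*2)%N.
Proof. by rewrite mnmBE mnmDE !mnm1E addnn. Qed.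

Lemma drop2K (d : nat) (a : multinom d) i : (1 < a i)%N ->
  bump2 (drop2 a i) i = a.
Proof.
move=> ai; apply/mnmP => j; rewrite bump2E drop2E.
by case: eqP => [<-|_]; [rewrite subnK|rewrite subn0 addn0].
Qed.

Lemma mdeg_drop2 (d : nat) (a : multinom d) i : (1 < a i)%N ->
  (mdeg (drop2 a i)).+2 = mdeg a.
Proof. by move=> ai; rewrite -[in RHS](drop2K ai) mdeg_bump2. Qed.

Lemma sphere_moment_drop (d : nat) (a : multinom d) i : (0 < a i)%N ->
  ((a i)%:R - 1) * sphere_moment (drop2 a i)
    = ((mdeg a)%:R + d%:R - 2) * sphere_moment a :> R.
Proof.
move=> a0; have [ai|] := ltnP 1 (a i).
  have := sphere_moment_bump (R := R) (drop2 a i) i.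
  rewrite drop2K// drop2E eqxx -(mdeg_drop2 ai) natrD -addn2 natrD addrAC addrK.
  move=> ->; rewrite -addn1 -[in LHS](subnK ai) !natrD; congr (_ * _); ring.
(* For exponent 1 the left side has a zero factor and the right side vanishes by parity. *)
move=> ai; have {a0 ai} ai : a i = 1%N by lia.
by rewrite (sphere_moment_odd (a := a) (i := i)) ?ai// subrr mul0r mulr0.
Qed.

(** This is the self-adjointness of the Laplace-Beltrami operator on monomials. With c = a + b, the
    i-th summand has the coefficient a_i (a_i - 1) - b_i (b_i - 1) = (a_i - b_i) (c_i - 1), and
    [sphere_moment_drop] turns the factor c_i - 1 into |c| + d - 2, independent of i. *)
Lemma sphere_moment_green (d : nat) (a b : multinom d) :
  \sum_(i < d) ((a i * (a i).-1)%:R * sphere_moment (mnm_add (drop2 a i) b)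
    - (b i * (b i).-1)%:R * sphere_moment (mnm_add a (drop2 b i)))
  = ((mdeg a)%:R - (mdeg b)%:R) * ((mdeg a)%:R + (mdeg b)%:R + d%:R - 2)
    * sphere_moment (mnm_add a b) :> R.
Proof.
have -> : (mdeg a)%:R - (mdeg b)%:R = \sum_(i < d) ((a i)%:R - (b i)%:R) :> R.
  by rewrite !mdegE !natr_sum sumrB.
rewrite -natrD -mdegD -mulrA mulr_suml.
apply: eq_bigr => i _; set c := mnm_add a b.
have aE : (a i * (a i).-1)%:R * sphere_moment (mnm_add (drop2 a i) b)
    = ((a i)%:R * ((a i)%:R - 1)) * sphere_moment (drop2 c i) :> R.
  have [ai|ai] := ltnP 1 (a i).
    have -> : mnm_add (drop2 a i) b = drop2 c i.
      apply/mnmP => j; rewrite mnmDE !drop2E mnmDE.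
      by case: eqP => [<-|_]; lia.
    by rewrite natrM -subn1 natrB// ltnW.
  by case: (a i) ai => [|[|]]// _; rewrite ?muln0 ?subrr ?mulr0 !mul0r.
have bE : (b i * (b i).-1)%:R * sphere_moment (mnm_add a (drop2 b i))
    = ((b i)%:R * ((b i)%:R - 1)) * sphere_moment (drop2 c i) :> R.
  have [bi|bi] := ltnP 1 (b i).
    have -> : mnm_add a (drop2 b i) = drop2 c i.
      apply/mnmP => j; rewrite mnmDE !drop2E mnmDE.
      by case: eqP => [<-|_]; lia.
    by rewrite natrM -subn1 natrB// ltnW.
  by case: (b i) bi => [|[|]]// _; rewrite ?muln0 ?subrr ?mulr0 !mul0r.
rewrite aE bE; have [c0|] := ltnP 0 (c i).
  rewrite -(sphere_moment_drop c0) mnmDE natrD; ring.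
rewrite mnmDE leqn0 addn_eq0 => /andP[/eqP-> /eqP->]; ring.
Qed.

Lemma continuous_eq0_itv (f : R -> R) (u v : R) : u < v -> continuous f ->
  (forall x, u < x < v -> f x = 0) -> forall x, u <= x <= v -> f x = 0.
Proof.
move=> uv cf f0 x /andP[]; rewrite le_eqVlt => /predU1P[<- _|ux].
  apply: (@norm_cvg_unique R R (f y @[y --> u^'+])).
  - exact: cvg_at_right_filter (cf u).
  - apply: cvg_near_cst; near=> y; apply: f0; apply/andP; split;
      near: y; [exact: nbhs_right_gt|exact: nbhs_right_lt].
rewrite le_eqVlt => /predU1P[->|xv]; last by apply: f0; rewrite ux.
apply: (@norm_cvg_unique R R (f y @[y --> v^'-])).
- exact: cvg_at_left_filter (cf v).
- apply: cvg_near_cst; near=> y; apply: f0; apply/andP; split;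
    near: y; [exact: nbhs_left_gt|exact: nbhs_left_lt].
Unshelve. all: by end_near. Qed.

Lemma sphere_spherical_coordP (d : nat) (xi : 'rV[R]_(1 + d.+1)) : sphere xi ->
  exists x (eta : 'rV[R]_d.+1),
    [/\ 0 <= x <= pi, sphere eta & xi = spherical_coord x eta].
Proof.
move=> /sphereP; rewrite big_split_ord/= big_ord1.
set c := xi 0 (lshift d.+1 ord0).
set S := \sum_(i < d.+1) _ => cS.
have S0 : 0 <= S by apply: sumr_ge0 => i _; exact: sqr_ge0.
have c1 : -1 <= c <= 1.
  by rewrite -ler_norml -(expr_le1 (n := 2))// real_normK ?num_real//; lra.
have sE : sin (acos c) = Num.sqrt S.
  by rewrite sin_acos//; congr Num.sqrt; lra.
exists (acos c).
have xiE (eta : 'rV[R]_d.+1) : rsubmx xi = Num.sqrt S *: eta ->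
    xi = spherical_coord (acos c) eta.
  move=> h; rewrite /spherical_coord sE -h acosK ?in_itv//.
  rewrite -[LHS]hsubmxK; congr row_mx; apply/rowP => i.
  by rewrite !mxE (ord1 i).
have x0 : 0 <= acos c <= pi by rewrite acos_ge0// acos_lepi.
(* At the two poles the sine is zero and any point of the smaller sphere serves as [eta]. *)
have [S00|Sn0] := eqVneq S 0.
  exists (delta_mx 0 0); split => //.
    apply/sphereP; rewrite (bigD1 ord0)//= mxE !eqxx expr1n big1 ?addr0//.
    by move=> i i0; rewrite mxE (negbTE i0) andbF expr0n.
  apply: xiE; rewrite S00 sqrtr0 scale0r; apply/rowP => j; rewrite !mxE.
  move/eqP: S00; rewrite psumr_eq0; last by move=> i _; exact: sqr_ge0.
  by move/allP => /(_ j (mem_index_enum _)); rewrite sqrf_eq0 => /eqP.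
have sS : Num.sqrt S != 0 by rewrite sqrtr_eq0 -ltNge lt_neqAle eq_sym Sn0.
exists ((Num.sqrt S)^-1 *: rsubmx xi); split => //.
  apply/sphereP; under eq_bigr do rewrite !mxE exprMn.
  by rewrite -mulr_sumr -/S exprVn sqr_sqrtr// mulVf.
by apply: xiE; rewrite scalerA divff// scale1r.
Qed.

(** The form of [f] as a sum of monomials carries the induction: slices have the same form, and the
    slice integral [h] is a trigonometric polynomial, hence continuous. *)
Lemma sphere_integral_eq0 (d : nat) (I : eqType) (r : seq I) (c : I -> R)
    (a : I -> multinom d) (f := fun x => \sum_(i <- r) c i * mono (a i) x) :
  (forall x, sphere x -> 0 <= f x) -> sphere_integral f = 0 ->
  forall x, sphere x -> f x = 0.
Proof.
elim: d I r c a @f => [|[|d] IH] I r c a f f0.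
- by move=> _ x /sphereP; rewrite big_ord0 => /eqP; rewrite eq_sym oner_eq0.
- rewrite sphere_integral1 => /eqP.
  have h1 := f0 _ (sphere_const1 false); have h2 := f0 _ (sphere_const1 true).
  rewrite paddr_eq0// => /andP[/eqP f1 /eqP fN1] x /sphereP.
  rewrite big_ord1 => /eqP; rewrite sqrf_eq1 => /orP[] /eqP xE.
    by rewrite -f1; congr f; apply/rowP => i; rewrite mxE ord1.
  by rewrite -fN1; congr f; apply/rowP => i; rewrite mxE ord1.
pose h (x : R) := sphere_integral (fun eta : 'rV[R]_d.+1 =>
  f (spherical_coord x eta)).
pose e (x : R) i := c i * (cos x ^+ mnm_head (a i : multinom (1 + d.+1)) *
  sin x ^+ mdeg (mnm_behead (a i : multinom (1 + d.+1)))).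
have fE (x : R) : (fun eta : 'rV[R]_d.+1 => f (spherical_coord x eta)) =
    (fun eta => \sum_(i <- r) e x i *
       mono (mnm_behead (a i : multinom (1 + d.+1))) eta).
  apply/funext => eta; apply: eq_bigr => i _.
  by rewrite mono_spherical_coord mulrA.
have ch : continuous h.
  have -> : h = fun x => \sum_(i <- r) e x i *
      sphere_moment (mnm_behead (a i : multinom (1 + d.+1))).
    by apply/funext => x; rewrite /h fE sphere_integral_sum.
  apply: continuous_big => [|i _ x]; first exact: add_continuous.
  apply: cvgMl; apply: cvgMr.
  exact: continuous_trig.
have h0 (x : R) : 0 <= x <= pi -> 0 <= h x.
  move=> x0; apply: sphere_integral_ge0 => eta Seta; apply: f0.
  exact: sphere_spherical_coord.
rewrite sphere_integralSS => int0.
pose g (x : R) := sin x ^+ d * h x.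
have cg : continuous g.
  move=> x; apply: cvgM; last exact: ch.
  have := @continuous_trig R 0 d x; under eq_fun do rewrite mul1r.
  exact.
have ig : mu.-integrable `]0, pi[ (EFin \o g).
  apply: integrableS (continuous_integrable_itv 0 pi cg) => //.
  exact: subset_itv_oo_cc.
have gint0 : \int[mu]_(x in `]0, pi[) g x = 0.
  rewrite -[RHS]int0 /Rintegral [in RHS]integral_itv_bndoo//.
  exact: measurable_int ig.
have hI (x : R) : 0 < x < pi -> h x = 0.
  move=> x0; have s0 := sin_gt0_pi x0.
  have /eqP : g x = 0.
    apply: (open_Rintegral_eq0 (U := `]0, pi[)) => // y.
    rewrite /= in_itv/= => /andP[y0 y1].
    by rewrite mulr_ge0 ?exprn_ge0 ?sin_ge0_pi ?h0 ?(ltW y0) ?(ltW y1).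
  by rewrite mulf_eq0 expf_eq0 (gt_eqF s0) andbF => /eqP.
move=> xi /(@sphere_spherical_coordP d)[x [eta [x0 Seta ->]]].
(* The weight sin^d may vanish at the poles, so there [h] is reached by continuity. *)
have hx0 : h x = 0 by exact: continuous_eq0_itv (pi_gt0 R) ch hI x x0.
have := congr1 (fun k => k eta) (fE x) => /= ->.
apply: IH => //; last by rewrite -fE.
move=> z Sz; have := congr1 (fun k => k z) (fE x) => /= <-.
by apply: f0; exact: sphere_spherical_coord.
Qed.

End SpherePositivity.

(** * Derivatives in the coordinates [(xi, t)] *)

Section ConeDerivatives.
Context {R : realType}.

(** Reduces directional derivatives to one real variable, where the chain rule for real powers
    applies. *)
Lemma is_derive_line (V : normedModType R) (f : V -> R) (y v : V) (df : R) :
  is_derive (0 : R) 1 (fun h => f (h *: v + y)) df -> is_derive y v f df.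
Proof.
have E : (fun h : R => h^-1 *: (((fun s => f (s *: v + y)) \o shift 0) (h *: 1)
      - f ((0 : R) *: v + y))) =
    (fun h => h^-1 *: ((f \o shift y) (h *: v) - f y)).
  by apply/funext => h; rewrite /= addr0 scale0r add0r /GRing.scale/= mulr1.
move=> [cf df0]; split; first by rewrite /derivable -E.
by rewrite -df0 /derive -E.
Qed.

Lemma is_derive_bigsum (V : normedModType R) (I : eqType) (r : seq I)
    (f : I -> V -> R) (df : I -> R) (x v : V) :
  (forall i, is_derive x v (f i) (df i)) ->
  is_derive x v (fun y => \sum_(i <- r) f i y) (\sum_(i <- r) df i).
Proof.
move=> fi; elim: r => [|i r IH].
  under eq_fun do rewrite big_nil.
  by rewrite big_nil; exact: is_derive_cst.
under eq_fun do rewrite big_cons.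
by rewrite big_cons; exact: is_deriveD.
Qed.

Definition sqnorm (d : nat) (y : 'rV[R]_d) : R := \sum_(i < d) y 0 i ^+ 2.

(* [y ^ a |y| ^ (- k)], a family closed under partial derivatives. *)
Definition mono_over_norm (d : nat) (a : multinom d) (k : nat)
    (y : 'rV[R]_d) : R :=
  mono a y * sqnorm y `^ (- (k%:R / 2)).

Lemma sqnorm_gt0 (d : nat) (y : 'rV[R]_d) : y != 0 -> 0 < sqnorm y.
Proof.
move=> y0; rewrite lt_neqAle eq_sym sumr_ge0 ?andbT; last first.
  by move=> i _; exact: sqr_ge0.
apply: contra y0; rewrite psumr_eq0; last by move=> i _; exact: sqr_ge0.
move=> /allP y0; apply/eqP/rowP => i; rewrite mxE.
by have := y0 i (mem_index_enum _); rewrite sqrf_eq0 => /eqP.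
Qed.

Lemma is_derive_mono_over_norm (d : nat) (a : multinom d) (k : nat)
    (i : 'I_d) (y : 'rV[R]_d) : y != 0 ->
  is_derive y (delta_mx 0 i) (mono_over_norm a k)
    ((a i)%:R * mono_over_norm (mnm_sub a (mnm1 i)) k y
     - k%:R * mono_over_norm (mnm_add a (mnm1 i)) k.+2 y).
Proof.
move=> y0; have s0 := sqnorm_gt0 y0; apply: is_derive_line.
pose C := \prod_(j < d | j != i) y 0 j ^+ a j.
pose Q := \sum_(j < d | j != i) y 0 j ^+ 2.
have lineE h j : (h *: delta_mx 0 i + y) 0 j = (j == i)%:R * h + y 0 j.
  by rewrite !mxE eqxx mulrC.
have monoE (b : multinom d) h : (forall j, j != i -> b j = a j) ->
    mono b (h *: delta_mx 0 i + y) = (h + y 0 i) ^+ b i * C.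
  move=> ba; rewrite /mono (bigD1 i)//= lineE eqxx mul1r; congr (_ * _).
  by apply: eq_bigr => j ji; rewrite lineE (negbTE ji) mul0r add0r ba.
have sqE h : sqnorm (h *: delta_mx 0 i + y) = (h + y 0 i) ^+ 2 + Q.
  rewrite /sqnorm (bigD1 i)//= lineE eqxx mul1r; congr (_ + _).
  by apply: eq_bigr => j ji; rewrite lineE (negbTE ji) mul0r add0r.
have at0 (b : multinom d) : (forall j, j != i -> b j = a j) ->
    mono b y = y 0 i ^+ b i * C.
  by move=> ba; have := monoE b 0 ba; rewrite scale0r !add0r.
have sq0 : sqnorm y = y 0 i ^+ 2 + Q.
  by have := sqE 0; rewrite scale0r !add0r.
have -> : (fun h : R => mono_over_norm a k (h *: delta_mx 0 i + y)) =
    (fun h => ((h + y 0 i) ^+ a i * C) *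
       ((h + y 0 i) ^+ 2 + Q) `^ (- (k%:R / 2))).
  by apply/funext => h; rewrite /mono_over_norm monoE// sqE.
have d1 : is_derive (0 : R) 1 (fun h => h + y 0 i) 1.
  by rewrite -[X in is_derive _ _ _ X]addr0; exact: is_deriveD.
have dX n : is_derive (0 : R) 1 (fun h => (h + y 0 i) ^+ n)
    (n%:R * y 0 i ^+ n.-1).
  have := @is_deriveX R R _ n _ _ _ d1.
  by rewrite exprfctE /GRing.scale/= add0r mulr1.
have dA : is_derive (0 : R) 1 (fun h => (h + y 0 i) ^+ a i * C)
    ((a i)%:R * y 0 i ^+ (a i).-1 * C).
  apply: (@is_derive_eq _ _ _ _ _ _ _ _
    (is_deriveM (dX (a i)) (is_derive_cst C (0 : R) 1))).
  by rewrite /GRing.scale/= mulr0 add0r mulrC.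
have dS : is_derive (0 : R) 1 (fun h => (h + y 0 i) ^+ 2 + Q) (2 * y 0 i).
  have := is_deriveD (dX 2) (is_derive_cst Q (0 : R) 1).
  by rewrite addr0 expr1.
have dP : is_derive (0 : R) 1
    (fun h => ((h + y 0 i) ^+ 2 + Q) `^ (- (k%:R / 2)))
    (- (k%:R / 2) * sqnorm y `^ (- (k%:R / 2) - 1) * (2 * y 0 i)).
  have s0' : 0 < (0 + y 0 i) ^+ 2 + Q by rewrite add0r -sq0.
  have := @is_derive1_comp R (fun x => x `^ (- (k%:R / 2)))
    (fun h => (h + y 0 i) ^+ 2 + Q) 0 _ _ (is_derive1_powR _ s0') dS.
  by rewrite add0r -sq0.
apply: (@is_derive_eq _ _ _ _ _ _ _ _ (is_deriveM dA dP)).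
rewrite /GRing.scale/= !add0r; rewrite -sq0 /mono_over_norm.
have ofsub : (a i)%:R * mono (mnm_sub a (mnm1 i)) y =
    (a i)%:R * y 0 i ^+ (a i).-1 * C.
  rewrite at0; last first.
    by move=> j ji; rewrite mnmBE mnm1E eq_sym (negbTE ji) subn0.
  by rewrite mnmBE mnm1E eqxx subn1 mulrA.
have ofadd : mono (mnm_add a (mnm1 i)) y = y 0 i ^+ a i * C * y 0 i.
  rewrite at0; last first.
    by move=> j ji; rewrite mnmDE mnm1E eq_sym (negbTE ji) addn0.
  by rewrite mnmDE mnm1E eqxx exprD expr1; ring.
rewrite mulrA ofsub ofadd.
have -> : - (k.+2%:R / 2) = - (k%:R / 2) - 1 :> R.
  by rewrite -addn2 natrD; field.
by field.
Qed.

Lemma mono_over_norm_sphere (d : nat) (a : multinom d) k (xi : 'rV[R]_d) :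
  sphere xi -> mono_over_norm a k xi = mono a xi.
Proof. by move=> /sphereP h; rewrite /mono_over_norm /sqnorm h powR1 mulr1. Qed.

Lemma mono_addsub (d : nat) (a : multinom d) i (x : 'rV[R]_d) :
  (a i)%:R * mono (mnm_add (mnm_sub a (mnm1 i)) (mnm1 i)) x
    = (a i)%:R * mono a x.
Proof.
have [->|ai] := posnP (a i); first by rewrite !mul0r.
congr (_ * mono _ _); apply/mnmP => j; rewrite mnmDE mnmBE mnm1E.
by case: eqP => [<-|_]; lia.
Qed.

Lemma neq0_sphere (d : nat) (xi : 'rV[R]_d) : sphere xi -> xi != 0.
Proof.
move=> /sphereP h; apply/eqP => x0; move: h; rewrite x0 big1 => [/eqP|i _].
  by rewrite eq_sym oner_eq0.
by rewrite mxE expr0n.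
Qed.

(** The extension of x^a from the sphere that is homogeneous of degree 0 is y^a |y|^(-|a|); hence
    the choice [mdeg (a e)] for the power of the norm. *)
Lemma laplacian_mono_over_norm (d : nat) (I : eqType) (r : seq I) (c : I -> R)
    (a : I -> multinom d) (f : 'rV[R]_d -> R) (xi : 'rV[R]_d) :
  sphere xi ->
  (forall y, y != 0 ->
    f y = \sum_(e <- r) c e * mono_over_norm (a e) (mdeg (a e)) y) ->
  laplacian f xi = \sum_(e <- r) c e *
    (\sum_(i < d) (a e i * (a e i).-1)%:R * mono (drop2 (a e) i) xi
     - (mdeg (a e))%:R * ((mdeg (a e))%:R + d%:R - 2) * mono (a e) xi).
Proof.
move=> Sxi fE; have xi0 := neq0_sphere Sxi.
have nz (y : 'rV[R]_d) : y != 0 -> \forall z \near y, z != 0.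
  by move=> y0; apply: (@cvgr_neq0 _ _ _ (nbhs y) _ id y) => //; exact: cvg_id.
pose D i e y : R := (a e i)%:R *
  mono_over_norm (mnm_sub (a e) (mnm1 i)) (mdeg (a e)) y -
  (mdeg (a e))%:R * mono_over_norm (mnm_add (a e) (mnm1 i)) (mdeg (a e)).+2 y.
(* The first derivative is computed off the sphere as well, because it is differentiated again. *)
have D1 i (y : 'rV[R]_d) : y != 0 ->
    'D_(delta_mx 0 i) f y = \sum_(e <- r) c e * D i e y.
  move=> y0.
  rewrite (near_eq_derive (g := fun y => \sum_(e <- r)
    c e * mono_over_norm (a e) (mdeg (a e)) y)); last first.
    by near=> z; apply: fE; near: z; exact: nz.
  apply: derive_val; apply: is_derive_bigsum => e.
  exact: is_deriveZ (is_derive_mono_over_norm _ _ _ y0).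
pose D2 i e : R := (a e i)%:R * ((mnm_sub (a e) (mnm1 i) i)%:R *
    mono (mnm_sub (mnm_sub (a e) (mnm1 i)) (mnm1 i)) xi
    - (mdeg (a e))%:R *
    mono (mnm_add (mnm_sub (a e) (mnm1 i)) (mnm1 i)) xi)
  - (mdeg (a e))%:R * ((mnm_add (a e) (mnm1 i) i)%:R *
    mono (mnm_sub (mnm_add (a e) (mnm1 i)) (mnm1 i)) xi
    - (mdeg (a e)).+2%:R *
    mono (mnm_add (mnm_add (a e) (mnm1 i)) (mnm1 i)) xi).
have DD i : 'D_(delta_mx 0 i) ('D_(delta_mx 0 i) f) xi =
    \sum_(e <- r) c e * D2 i e.
  rewrite (near_eq_derive (g := fun y => \sum_(e <- r) c e * D i e y));
    last first.
    by near=> z; apply: D1; near: z; exact: nz.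
  apply: derive_val; apply: is_derive_bigsum => e; apply: is_deriveZ.
  have d1 := is_deriveZ (a e i)%:R (is_derive_mono_over_norm
    (mnm_sub (a e) (mnm1 i)) (mdeg (a e)) i xi0).
  have d2 := is_deriveZ (mdeg (a e))%:R (is_derive_mono_over_norm
    (mnm_add (a e) (mnm1 i)) (mdeg (a e)).+2 i xi0).
  apply: (@is_derive_eq _ _ _ _ _ _ _ _ (is_deriveB d1 d2)).
  by rewrite /D2 !mono_over_norm_sphere.
rewrite /laplacian; under eq_bigr do rewrite DD.
rewrite exchange_big/=; apply: eq_bigr => e _; rewrite -mulr_sumr.
congr (_ * _); rewrite /D2; move: (a e) => b {fE DD D2 D1 D}; set m := (mdeg b)%:R.
pose B i : R := (b i * (b i).-1)%:R * mono (drop2 b i) xi.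
(* Summing over i, the factors b_i, b_i + 1 and xi_i^2 give m, m + d and 1, so the scalar is - m^2 -
   m (m + d) + m (m + 2) = - m (m + d - 2). *)
transitivity (\sum_(i < d) (B i - m * (b i)%:R * mono b xi -
    m * ((b i)%:R + 1) * mono b xi + m * (m + 2) * mono b xi * xi 0 i ^+ 2)).
  apply: eq_bigr => i _.
  have -> : mnm_sub (mnm_sub b (mnm1 i)) (mnm1 i) = drop2 b i.
    by apply/mnmP => j; rewrite !mnmBE mnmDE subnDA.
  have -> : mnm_sub (mnm_add b (mnm1 i)) (mnm1 i) = b.
    by apply/mnmP => j; rewrite mnmBE mnmDE addnK.
  have monoU b' : mono (mnm_add b' (mnm1 i)) xi = mono b' xi * xi 0 i.
    rewrite monoD; congr (_ * _); rewrite /mono (bigD1 i)//= mnm1E eqxx.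
    by rewrite big1 ?mulr1// => j ji; rewrite mnm1E eq_sym (negbTE ji).
  have h := mono_addsub b i xi.
  rewrite mulrBr [X in _ - X - _]mulrCA h !monoU mnmBE mnmDE mnm1E eqxx.
  by rewrite subn1 addn1 /B natrM -!addn1 !natrD -/m; ring.
rewrite big_split/= sumrB sumrB -mulr_sumr (proj1 (sphereP _) Sxi) mulr1.
rewrite -!mulr_suml -!mulr_sumr big_split/= -!natr_sum -mdegE -/m.
rewrite sumr_const card_ord; ring.
Unshelve. all: by end_near. Qed.

End ConeDerivatives.

(** * Polynomials on the cone *)

Section ConePolynomials.
Context {R : realType} (d : nat).
Notation mu := (@lebesgue_measure R).

(* [(c, a, k)] stands for the function [c * x ^ a * t ^ k] on the cone. *)
Definition cone_term : Type := (R * multinom d * nat)%type.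

Definition term_deg (e : cone_term) : nat := (mdeg e.1.2 + e.2)%N.

Definition cone_eval (r : seq cone_term) (xi : 'rV[R]_d) (t : R) : R :=
  \sum_(e <- r) e.1.1 * (t ^+ term_deg e * mono e.1.2 xi).

Definition represents (r : seq cone_term) (f : 'rV[R]_d * R -> R) : Prop :=
  forall xi t, sphere xi -> 0 <= t -> f (t *: xi, t) = cone_eval r xi t.

Lemma monoZ (a : multinom d) (s : R) (x : 'rV[R]_d) :
  mono a (s *: x) = s ^+ mdeg a * mono a x.
Proof.
rewrite mdegE -prodrXr -big_split/=; apply: eq_bigr => i _.
by rewrite mxE exprMn.
Qed.

Lemma cone_surface_ray (xi : 'rV[R]_d) t : sphere xi -> 0 <= t ->
  cone_surface (t *: xi, t).
Proof.
move=> /sphereP Sxi t0; split => //=; rewrite /enorm.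
under eq_bigr do rewrite mxE exprMn.
by rewrite -mulr_sumr Sxi mulr1 sqrtr_sqr ger0_norm.
Qed.

Definition mnm_belast (m : multinom (d + 1)) : multinom d :=
  Multinom (mktuple (fun i => m (lshift 1 i))).

Definition mnm_last (m : multinom (d + 1)) : nat := m (rshift d ord0).

Definition mnm_rcons (a : multinom d) (k : nat) : multinom (d + 1) :=
  Multinom (mktuple (fun i : 'I_(d + 1) => match fintype.split i with inl j => a j | inr _ => k end)).

Lemma mdeg_belast m : mdeg m = (mdeg (mnm_belast m) + mnm_last m)%N.
Proof.
rewrite !mdegE big_split_ord/= big_ord1; congr (_ + _)%N.
by apply: eq_bigr => i _; rewrite mnmE.
Qed.

Lemma mnm_rconsK a k :
  mnm_belast (mnm_rcons a k) = a /\ mnm_last (mnm_rcons a k) = k.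
Proof.
split; last by rewrite /mnm_last mnmE (unsplitK (inr ord0)).
by apply/mnmP => i; rewrite !mnmE (unsplitK (inl i)).
Qed.

Lemma prod_row_mx (m : multinom (d + 1)) (x : 'rV[R]_d) (t : R) :
  \prod_i (row_mx x (const_mx t : 'rV[R]_1) 0 i) ^+ m i
    = mono (mnm_belast m) x * t ^+ mnm_last m.
Proof.
rewrite big_split_ord/= big_ord1 row_mxEr mxE; congr (_ * _).
by apply: eq_bigr => i _; rewrite row_mxEl mnmE.
Qed.

Lemma cone_poly_represents (m : nat) (f : 'rV[R]_d * R -> R) :
  cone_poly m f ->
  exists2 r, represents r f & {in r, forall e, (term_deg e < m)%N}.
Proof.
move=> [P Pm fP].
exists [seq (mcoeff x P, mnm_belast x, mnm_last x) | x <- msupp P].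
  move=> xi t Sxi t0; rewrite fP; last exact: cone_surface_ray.
  rewrite mevalE /cone_eval [RHS]big_map; apply: eq_bigr => x _ /=.
  by rewrite prod_row_mx monoZ /term_deg/= exprD; ring.
move=> _ /mapP[x xP ->]; rewrite /term_deg/= -mdeg_belast.
exact: leq_trans (mmeasure_mnm_lt _ xP) Pm.
Qed.

(** Turns a formal list into an actual test function, to which the orthogonality of v can be
    applied. *)
Lemma represents_cone_poly (m : nat) (r : seq cone_term) :
  {in r, forall e, (term_deg e < m)%N} ->
  exists2 f, cone_poly m f & represents r f.
Proof.
move=> rm; pose P : mpoly (d + 1) R :=
  \sum_(e <- r) e.1.1 *: mpolyX R (mnm_rcons e.1.2 e.2).
exists (fun z => meval (row_mx z.1 (const_mx z.2 : 'rV[R]_1) 0) P).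
  exists P => //; rewrite /P big_seq.
  apply: leq_trans (mmeasure_sum _ _ _ _) _.
  apply/bigmax_leqP_seq => e er _; apply: leq_trans (mmeasureZ_le _ _ _) _.
  rewrite mmeasureX; apply: leq_ltn_trans (rm e er).
  rewrite [leqLHS](mdeg_belast (mnm_rcons e.1.2 e.2)).
  by have [-> ->] := mnm_rconsK e.1.2 e.2.
move=> xi t Sxi t0; rewrite /P raddf_sum/=; apply: eq_bigr => e _.
rewrite mevalZ mevalX prod_row_mx /=.
have [-> ->] := mnm_rconsK e.1.2 e.2.
by rewrite monoZ /term_deg exprD; ring.
Qed.

(** The inner product of two monomials. The shift [d.-2] joins t^(d-1) from the measure and t^(-1)
    from the weight; [p - 1] comes from (1 + t)^(1-p). *)
Definition term_moment (p : R) (e e' : multinom d * nat) : R :=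
  sphere_moment (mnm_add e.1 e'.1) *
  half_line_moment (mdeg e.1 + e.2 + (mdeg e'.1 + e'.2) + d.-2) (p - 1).

Definition pairing (p : R) (r s : seq cone_term) : R :=
  \sum_(e <- r) \sum_(e' <- s) e.1.1 * e'.1.1 *
    term_moment p (e.1.2, e.2) (e'.1.2, e'.2).

(** The integrand in t of the inner product, once the sphere has been integrated out. *)
Definition cone_density (p : R) (r s : seq cone_term) (t : R) : R :=
  \sum_(x <- [seq (e, e') | e <- r, e' <- s])
    (x.1.1.1 * x.2.1.1 * sphere_moment (mnm_add x.1.1.2 x.2.1.2)) *
    (t ^+ (term_deg x.1 + term_deg x.2 + d.-2) * (1 + t) `^ (- (p - 1))).

Lemma cone_eval_mul (r s : seq cone_term) (w t : R) (xi : 'rV[R]_d) :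
  w * (cone_eval r xi t * cone_eval s xi t)
  = \sum_(x <- [seq (e, e') | e <- r, e' <- s])
      w * (x.1.1.1 * x.2.1.1 * t ^+ (term_deg x.1 + term_deg x.2)) *
      mono (mnm_add x.1.1.2 x.2.1.2) xi.
Proof.
rewrite big_allpairs/= mulr_suml mulr_sumr.
apply: eq_bigr => e _; rewrite 2!mulr_sumr; apply: eq_bigr => e' _ /=.
by rewrite monoD exprD; ring.
Qed.

Lemma sphere_integral_mul (r s : seq cone_term) (w t : R) :
  sphere_integral (fun xi => w * (cone_eval r xi t * cone_eval s xi t))
  = w * \sum_(x <- [seq (e, e') | e <- r, e' <- s])
      x.1.1.1 * x.2.1.1 * t ^+ (term_deg x.1 + term_deg x.2) *
      sphere_moment (mnm_add x.1.1.2 x.2.1.2).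
Proof.
under [X in sphere_integral X]eq_fun do rewrite cone_eval_mul.
rewrite sphere_integral_sum mulr_sumr; apply: eq_bigr => x _.
by rewrite !mulrA.
Qed.

Lemma cone_densityE (p : R) (r s : seq cone_term) (t : R) :
  cone_density p r s t = sphere_integral (fun xi =>
    t ^+ d.-2 * (1 + t) `^ (1 - p) * (cone_eval r xi t * cone_eval s xi t)).
Proof.
rewrite sphere_integral_mul mulr_sumr; apply: eq_bigr => x _.
by rewrite opprB !exprD; ring.
Qed.

Lemma cone_density_integrable (p : R) (r s : seq cone_term) : (2 <= d)%N ->
  {in r & s, forall e e', (term_deg e + term_deg e' + d)%:R < p} ->
  mu.-integrable `]0, +oo[ (EFin \o cone_density p r s) /\
  \int[mu]_(t in `]0, +oo[) cone_density p r s t = pairing p r s.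
Proof.
move=> d2 rsp.
have int (x : cone_term * cone_term) :
    x \in [seq (e, e') | e <- r, e' <- s] -> mu.-integrable `]0, +oo[
    (EFin \o (fun t : R => t ^+ (term_deg x.1 + term_deg x.2 + d.-2) *
       (1 + t) `^ (- (p - 1)))).
  move=> /allpairsP[[e e'] [er es ->]] /=; apply: half_line_integrable.
  have := rsp _ _ er es.
  rewrite -[X in (_ + X)%:R < _](subnK d2) addnA natrD -subn2 -natr1; lra.
have [] := @Rintegral_sum R `]0, +oo[ _ [seq (e, e') | e <- r, e' <- s]
   (fun x t => (x.1.1.1 * x.2.1.1 * sphere_moment (mnm_add x.1.1.2 x.2.1.2)) *
    (t ^+ (term_deg x.1 + term_deg x.2 + d.-2) * (1 + t) `^ (- (p - 1)))).
- exact: measurable_itv.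
- by move=> x /int ix; exact: (integrableZl _ _ ix).
move=> i1 i2; split; first exact: i1.
rewrite [LHS]i2 big_seq (eq_bigr (fun x =>
    (x.1.1.1 * x.2.1.1 * sphere_moment (mnm_add x.1.1.2 x.2.1.2)) *
    half_line_moment (term_deg x.1 + term_deg x.2 + d.-2) (p - 1))).
  rewrite -big_seq big_allpairs; apply: eq_bigr => e _.
  by apply: eq_bigr => e' _; rewrite /= mulrA.
by move=> x /int ix; rewrite RintegralZl.
Qed.

Lemma cone_innerE (p : R) (r s : seq cone_term) f g : (2 <= d)%N ->
  represents r f -> represents s g ->
  {in r & s, forall e e', (term_deg e + term_deg e' + d)%:R < p} ->
  cone_inner p f g = pairing p r s.
Proof.
move=> d2 rf sg rsp; rewrite -(cone_density_integrable d2 rsp).2.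
rewrite /cone_inner /cone_integral; apply: eq_Rintegral => t.
rewrite inE/= in_itv/= andbT => t0.
rewrite (@eq_sphere_integral _ _ _ (fun xi => cone_weight p t *
    (cone_eval r xi t * cone_eval s xi t))); last first.
  by move=> xi Sxi /=; rewrite rf ?ltW// sg ?ltW// mulrC.
rewrite cone_densityE !sphere_integral_mul mulrA; congr (_ * _).
(* For d >= 2 the factor t^(-1) is absorbed by t^(d-1), so no singularity at 0 remains. *)
rewrite /cone_weight; case: (d) d2 => [|[|d']]// _ /=.
by rewrite exprS; field; rewrite gt_eqF.
Qed.

End ConePolynomials.

(** * The formal operator: degree, self-adjointness, definiteness of the pairing *)

Section ConeOperator.
Context {R : realType} (d : nat).
Implicit Types (p lam : R) (r s : seq (cone_term (R := R) d)).

(* On [x ^ a * t ^ k] with [N = |a| + k], the differential operator minus [lam]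
   acts as multiplication by [N (N + d - p) - lam], plus [k (2 |a| + k + d - 2)]
   times the lowering of [k], plus [t] times the Laplacian in [x]. *)
Definition cone_op_term p lam (e : cone_term (R := R) d) :
    seq (cone_term (R := R) d) :=
  let N := (term_deg e)%:R in
  [:: (e.1.1 * (N * (N + d%:R - p) - lam), e.1.2, e.2),
      (e.1.1 * (e.2%:R * (2 * (mdeg e.1.2)%:R + e.2%:R + d%:R - 2)),
        e.1.2, e.2.-1) &
      [seq (e.1.1 * (e.1.2 i * (e.1.2 i).-1)%:R, drop2 e.1.2 i, e.2.+1)
        | i <- enum 'I_d]].

(** Dropping zero coefficients makes the degree of every remaining entry meaningful: cancelled
    leading terms and entries with truncated exponents disappear. *)
Definition cone_op p lam r :=
  [seq x <- flatten [seq cone_op_term p lam e | e <- r] | x.1.1 != 0].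

(** The transposed operator: [K] gives the values of a linear functional on monomials. It is used
    for pairing with a fixed monomial, on either side, and for evaluation at a point. *)
Definition cone_op_fun p lam (K : multinom d -> nat -> R) (a : multinom d)
    (k : nat) : R :=
  let N := (mdeg a + k)%:R in
  (N * (N + d%:R - p) - lam) * K a k
  + k%:R * (2 * (mdeg a)%:R + k%:R + d%:R - 2) * K a k.-1
  + \sum_(i < d) (a i * (a i).-1)%:R * K (drop2 a i) k.+1.

Lemma cone_op_sum p lam r (K : multinom d -> nat -> R) :
  \sum_(x <- cone_op p lam r) x.1.1 * K x.1.2 x.2
    = \sum_(e <- r) e.1.1 * cone_op_fun p lam K e.1.2 e.2.
Proof.
rewrite /cone_op big_filter big_mkcond/=.
rewrite (eq_bigr (fun x => x.1.1 * K x.1.2 x.2)); last first.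
  by move=> x _; case: eqP => //= ->; rewrite mul0r.
rewrite big_flatten big_map; apply: eq_bigr => e _.
rewrite !big_cons big_map big_enum/= /cone_op_fun !mulrDr mulr_sumr -!addrA.
congr (_ + (_ + _)); [ring|ring|].
by apply: eq_bigr => i _; rewrite mulrA.
Qed.

Lemma cone_op_deg p (n : nat) r :
  {in r, forall e, (term_deg e <= n)%N} ->
  {in cone_op p (n%:R * (n%:R - p + d%:R)) r, forall x, (term_deg x < n)%N}.
Proof.
move=> rn x; rewrite mem_filter => /andP[x0 /flattenP[_ /mapP[e er ->]]].
have := rn e er; rewrite leq_eqVlt /term_deg => en.
rewrite !inE => /or3P[/eqP xE|/eqP xE|/mapP[i _ xE]].
(* In degree exactly n the scalar n (n + d - p) - lam is zero, so the entry was filtered out. *)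
- move: x0; rewrite {}xE /term_deg/= mulf_eq0 negb_or => /andP[_].
  case/predU1P: en => // ->; rewrite subr_eq0 => /eqP[].
  ring.
(* A surviving lowered entry has k > 0, or a_i > 1 in the last case, so its degree really drops by
   one. *)
- move: x0; rewrite {}xE/= !mulf_eq0 !negb_or pnatr_eq0 -lt0n.
  by move=> /andP[_ /andP[k0 _]]; lia.
- move: x0; rewrite {}xE/= mulf_eq0 negb_or pnatr_eq0 => /andP[_ ai].
  have a1 : (1 < e.1.2 i)%N by case: (e.1.2 i) ai => [|[|]].
  by move: en; rewrite -(mdeg_drop2 a1); move: (mdeg (drop2 _ _)) => z; lia.
Qed.

(** Put N = |a| + k, N' = |b| + l and m = N + N'. By Green's identity the terms of degree m - 1
    combine to (N - N') (m + d - 2) M B', and those of degree m to - (N - N') (p - m - d) M B. The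
    half-line recurrence makes them cancel. *)
Lemma cone_op_self_adjoint p lam (a b : multinom d) (k l : nat) :
  (2 <= d)%N -> (mdeg a + k + (mdeg b + l) + d)%:R < p ->
  cone_op_fun p lam (fun a' k' => term_moment p (a', k') (b, l)) a k
  = cone_op_fun p lam (fun b' l' => term_moment p (a, k) (b', l')) b l.
Proof.
move=> d2 mp; rewrite /cone_op_fun /term_moment/=.
set m := (mdeg a + k + (mdeg b + l))%N in mp *.
pose B := half_line_moment (m + d.-2) (p - 1).
pose B' := half_line_moment (m.-1 + d.-2) (p - 1).
pose M : R := sphere_moment (mnm_add a b).
have kE : k%:R * (2 * (mdeg a)%:R + k%:R + d%:R - 2) *
    (M * half_line_moment (mdeg a + k.-1 + (mdeg b + l) + d.-2) (p - 1)) =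
    k%:R * (2 * (mdeg a)%:R + k%:R + d%:R - 2) * (M * B').
  case: (posnP k) => [->|k0]; first by rewrite !mul0r.
  have -> // : (mdeg a + k.-1 + (mdeg b + l) = m.-1)%N by rewrite /m; lia.
have lE : l%:R * (2 * (mdeg b)%:R + l%:R + d%:R - 2) *
    (M * half_line_moment (mdeg a + k + (mdeg b + l.-1) + d.-2) (p - 1)) =
    l%:R * (2 * (mdeg b)%:R + l%:R + d%:R - 2) * (M * B').
  case: (posnP l) => [->|l0]; first by rewrite !mul0r.
  have -> // : (mdeg a + k + (mdeg b + l.-1) = m.-1)%N by rewrite /m; lia.
have aE : \sum_(i < d) (a i * (a i).-1)%:R *
    (sphere_moment (mnm_add (drop2 a i) b) *
     half_line_moment (mdeg (drop2 a i) + k.+1 + (mdeg b + l) + d.-2) (p - 1))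
    = B' * \sum_(i < d)
      (a i * (a i).-1)%:R * sphere_moment (mnm_add (drop2 a i) b).
  rewrite mulr_sumr; apply: eq_bigr => i _.
  case: (ltnP 1 (a i)) => [ai|]; last first.
    by case: (a i) => [|[|]]// _; rewrite muln0 !mul0r mulr0.
  rewrite mulrA mulrC; congr (half_line_moment _ _ * _).
  by have := mdeg_drop2 ai; lia.
have bE : \sum_(i < d) (b i * (b i).-1)%:R *
    (sphere_moment (mnm_add a (drop2 b i)) *
     half_line_moment (mdeg a + k + (mdeg (drop2 b i) + l.+1) + d.-2) (p - 1))
    = B' * \sum_(i < d)
      (b i * (b i).-1)%:R * sphere_moment (mnm_add a (drop2 b i)).
  rewrite mulr_sumr; apply: eq_bigr => i _.
  case: (ltnP 1 (b i)) => [bi|]; last first.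
    by case: (b i) => [|[|]]// _; rewrite muln0 !mul0r mulr0.
  rewrite mulrA mulrC; congr (half_line_moment _ _ * _).
  by have := mdeg_drop2 bi; lia.
rewrite -/M -/B kE lE aE bE {kE lE aE bE}.
have := sphere_moment_green (R := R) a b; rewrite sumrB -/M => /eqP.
rewrite subr_eq => /eqP ->.
(* The recurrence at j = m + d - 3 and s = p - 1 requires j + 2 < s, which is the hypothesis m + d <
   p. *)
have BE : (0 < m)%N -> (m%:R + d%:R - 2) * B' = (p - m%:R - d%:R) * B.
  move=> m0; have := half_line_moment_step (j := m.-1 + d.-2) (s := p - 1).
  have -> : (m.-1 + d.-2).+2%:R = m%:R + d%:R - 1 :> R.
    by apply: (addIr 1); rewrite subrK natr1 -natrD; congr (_%:R); lia.
  have -> : (m.-1 + d.-2).+1%:R = m%:R + d%:R - 2 :> R.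
    by apply: (addIr 2); rewrite subrK -!natrD; congr (_%:R); lia.
  have -> : (m.-1 + d.-2).+1 = (m + d.-2)%N by lia.
  rewrite -/B -/B' => ->; last by move: mp; rewrite natrD; lra.
  by congr (_ * _); ring.
have [m0|m0] := posnP m.
  have [a0 k0 b0 l0] : [/\ mdeg a = 0, k = 0, mdeg b = 0 & l = 0]%N.
    by split; move: m0; rewrite /m; lia.
  by rewrite a0 k0 b0 l0; ring.
have {}BE := BE m0; move: BE; rewrite /m !natrD.
set x := (mdeg a)%:R; set y := (mdeg b)%:R.
set kk := k%:R; set ll := l%:R; set D := d%:R => BE.
apply/eqP; rewrite -subr_eq0; apply/eqP.
transitivity (M * (x + kk - y - ll) *
  ((x + kk + (y + ll) + D - 2) * B' - (p - (x + kk + (y + ll)) - D) * B)).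
  ring.
by rewrite BE subrr mulr0.
Qed.

Lemma pairing_cone_op p lam r s : (2 <= d)%N ->
  {in r & s, forall e e', (term_deg e + term_deg e' + d)%:R < p} ->
  pairing p (cone_op p lam r) s = pairing p r (cone_op p lam s).
Proof.
move=> d2 rsp; rewrite /pairing.
transitivity (\sum_(e <- r) e.1.1 * cone_op_fun p lam (fun a k =>
    \sum_(e' <- s) e'.1.1 * term_moment p (a, k) (e'.1.2, e'.2)) e.1.2 e.2).
  rewrite -cone_op_sum; apply: eq_bigr => x _.
  by rewrite mulr_sumr; apply: eq_bigr => e' _; rewrite mulrA.
rewrite !big_seq; apply: eq_bigr => e er.
transitivity (e.1.1 * \sum_(e' <- s) e'.1.1 * cone_op_fun p lam
    (fun a k => term_moment p (a, k) (e'.1.2, e'.2)) e.1.2 e.2).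
  congr (_ * _); rewrite /cone_op_fun !mulr_sumr.
  under [X in _ + _ + X]eq_bigr do rewrite mulr_sumr.
  rewrite exchange_big/= -!big_split/=; apply: eq_bigr => e' _.
  rewrite !mulrDr mulr_sumr; congr (_ + _ + _); [ring|ring|].
  by apply: eq_bigr => i _; ring.
transitivity (e.1.1 * \sum_(e' <- s) e'.1.1 * cone_op_fun p lam
    (fun b l => term_moment p (e.1.2, e.2) (b, l)) e'.1.2 e'.2).
  congr (_ * _); rewrite !big_seq; apply: eq_bigr => e' es; congr (_ * _).
  by apply: cone_op_self_adjoint => //; exact: rsp.
rewrite -cone_op_sum mulr_sumr; apply: eq_bigr => x _.
by rewrite mulrA.
Qed.

(** Definiteness in two stages: the nonnegative continuous density vanishes at each t > 0, and then
    so does the square integrated over the sphere. *)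
Lemma pairing_eq0 p r : (2 <= d)%N ->
  {in r &, forall e e', (term_deg e + term_deg e' + d)%:R < p} ->
  pairing p r r = 0 ->
  forall xi t, sphere xi -> 0 < t -> cone_eval r xi t = 0.
Proof.
move=> d2 rp; have [idens <-] := cone_density_integrable d2 rp => dens0.
move=> xi t Sxi t0.
have w0 (x : R) : 0 < x -> 0 < x ^+ d.-2 * (1 + x) `^ (1 - p).
  by move=> x0; rewrite mulr_gt0 ?exprn_gt0// powR_gt0//; lra.
have : cone_density p r r t = 0.
  apply: (open_Rintegral_eq0 (U := `]0, +oo[)) => //.
  - move=> x; rewrite inE/= in_itv/= andbT => /ltW x0.
    apply: cvg_big => [|y _]; first exact: add_continuous.
    by apply: cvgMr; exact: continuous_half_line.
  - move=> x; rewrite /= in_itv/= andbT => x0; rewrite cone_densityE.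
    apply: sphere_integral_ge0 => eta _.
    by rewrite mulr_ge0 ?(ltW (w0 _ x0))// -expr2 sqr_ge0.
  - by rewrite /= in_itv/= andbT.
rewrite cone_densityE.
move=> int0; pose w := t ^+ d.-2 * (1 + t) `^ (1 - p).
have := int0; under [X in sphere_integral X]eq_fun do rewrite cone_eval_mul.
move=> /sphere_integral_eq0 h.
have : w * (cone_eval r xi t * cone_eval r xi t) = 0.
  rewrite cone_eval_mul; apply: h => // eta _; rewrite -cone_eval_mul.
  by rewrite mulr_ge0 ?(ltW (w0 _ t0))// -expr2 sqr_ge0.
move=> /eqP; rewrite mulf_eq0 gt_eqF ?w0//= mulf_eq0 orbb.
by move/eqP.
Qed.

End ConeOperator.

(** * From the formal operator to the differential equation *)

Lemma derive1_half_line_poly (R : realType) (I : eqType) (r : seq I)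
    (c : I -> R) (N : I -> nat) (f : R -> R) :
  (forall s : R, 0 < s -> f s = \sum_(e <- r) c e * s ^+ N e) ->
  forall t : R, 0 < t -> derive1 f t = \sum_(e <- r) c e * (N e)%:R * t ^+ (N e).-1.
Proof.
move=> fE t t0; rewrite derive1E.
rewrite (near_eq_derive (g := fun s : R => \sum_(e <- r) c e * s ^+ N e)); last first.
  by near=> s; apply: fE; near: s; exact: lt_nbhsr.
apply: derive_val; apply: is_derive_bigsum => e; rewrite -mulrA.
have dX : is_derive t 1 (fun s : R => s ^+ N e) ((N e)%:R * t ^+ (N e).-1).
  have := @is_deriveX R R id (N e) t 1 1 _.
  by rewrite exprfctE /GRing.scale/= mulr1; exact.
exact: is_deriveZ.
Unshelve. all: by end_near. Qed.

(** Normalizing y turns x^a into y^a |y|^(-|a|), the case of [laplacian_mono_over_norm]. *)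
Lemma laplace_beltrami_represents (R : realType) (d : nat)
    (r : seq (cone_term (R := R) d)) (v : 'rV[R]_d * R -> R) (xi : 'rV[R]_d)
    (t : R) :
  represents r v -> sphere xi -> 0 <= t ->
  laplace_beltrami (fun eta => v (t *: eta, t)) xi
  = \sum_(e <- r) e.1.1 * t ^+ term_deg e *
    (\sum_(i < d) (e.1.2 i * (e.1.2 i).-1)%:R * mono (drop2 e.1.2 i) xi
     - (mdeg e.1.2)%:R * ((mdeg e.1.2)%:R + d%:R - 2) * mono e.1.2 xi).
Proof.
move=> rv Sxi t0; apply: (laplacian_mono_over_norm (a := fun e => e.1.2)) => //.
move=> y y0; have s0 := sqnorm_gt0 y0.
have n0 : enorm y != 0 by rewrite /enorm sqrtr_eq0 -ltNge.
rewrite rv//; last first.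
  apply/sphereP; under eq_bigr do rewrite mxE exprMn.
  by rewrite -mulr_sumr exprVn /enorm sqr_sqrtr ?(ltW s0)// mulVf// gt_eqF.
apply: eq_bigr => e _; rewrite monoZ /mono_over_norm -mulrA; congr (_ * (_ * _)).
rewrite mulrC; congr (_ * _).
rewrite /enorm -powR12_sqrt ?(ltW s0)// -powRN.
by rewrite -powR_mulrn ?powR_ge0// -powRrM mulNr mulrC.
Qed.

Theorem theorem3p9 (R : realType) (d n : nat) (p : R)
  (d_ge2 : (2 <= d)%N) (p_gt : (2 * n + d)%:R < p)
  (v : 'rV[R]_d * R -> R) (v_orth : cone_orthopoly p n v)
  (xi : 'rV[R]_d) (xi_sphere : sphere xi) (t : R) (t_gt0 : 0 < t) :
  let u := fun (eta : 'rV[R]_d) (s : R) => v (s *: eta, s) in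
  t * (1 + t) * derive1n 2 (u xi) t
    + (d%:R - 1 + (- p + d%:R + 1) * t) * derive1 (u xi) t
    + t^-1 * laplace_beltrami (fun eta => u eta t) xi
  = n%:R * (n%:R - p + d%:R) * u xi t.
Proof.
move=> u; have [/cone_poly_represents[r rv rn] orth] := v_orth.
pose lam : R := n%:R * (n%:R - p + d%:R).
have small (m : nat) : (m <= 2 * n)%N -> (m + d)%:R < p.
  by move=> mn; apply: le_lt_trans p_gt; rewrite ler_nat leq_add2r.
pose r1 := cone_op p lam r; pose r2 := cone_op p lam r1.
have r1n : {in r1, forall e, (term_deg e < n)%N} by exact: cone_op_deg.
have r2n : {in r2, forall e, (term_deg e < n)%N}.
  by apply: cone_op_deg => e /r1n/ltnW.
(* With w the function of [r1], [q] is the image of w, of degree < n; self-adjointness rewrites the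
   pairing of w with itself as that of v with [q], which is zero. *)
have [q qn r2q] := represents_cone_poly r2n.
have r1_0 : forall eta s, sphere eta -> 0 < s -> cone_eval r1 eta s = 0.
  apply: (@pairing_eq0 _ _ p) => //.
    by move=> e e' /r1n en /r1n en'; apply: small; lia.
  rewrite /r1 pairing_cone_op//; last first.
    by move=> e e' /rn en /r1n en'; apply: small; lia.
  rewrite -(cone_innerE d_ge2 rv r2q) ?orth//.
  by move=> e e' /rn en /r2n en'; apply: small; lia.
pose c (e : cone_term (R := R) d) := e.1.1 * mono e.1.2 xi.
have uE (s : R) : 0 < s -> u xi s = \sum_(e <- r) c e * s ^+ term_deg e.
  move=> s0; rewrite /u rv ?(ltW s0)//; apply: eq_bigr => e _.
  by rewrite /c; ring.
have u1 := derive1_half_line_poly uE.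
(* The formula for the first derivative again has the shape of the hypothesis, so the lemma
   iterates. *)
have u2 := derive1_half_line_poly u1.
have -> : derive1n 2 (u xi) t = derive1 (derive1 (u xi)) t by [].
rewrite u1// u2// (laplace_beltrami_represents rv) ?(ltW t_gt0)// uE//.
have h := r1_0 xi t xi_sphere t_gt0.
(* Here the functional is evaluation of x^a t^k at (t xi, t). *)
rewrite /cone_eval (cone_op_sum p lam r (fun a k => t ^+ (mdeg a + k) * mono a xi)) in h.
apply/eqP; rewrite -subr_eq0 -/lam; apply/eqP; rewrite -[RHS]h.
rewrite !mulr_sumr -!big_split -sumrB/=; apply: eq_bigr => e _.
rewrite /cone_op_fun /c /term_deg.
move: e.1.1 e.1.2 e.2 => z a k; set N := (mdeg a + k)%N.
have t0 : t != 0 by rewrite gt_eqF.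
(* [T] is t^(N-1) without truncation at N = 0; all powers are expressed through it. *)
pose T := t^-1 * t ^+ N; have TE : t ^+ N = t * T by rewrite mulVKf.
have d1 : N%:R * t ^+ N.-1 = N%:R * T.
  rewrite /T; case: (N) => [|N']; first by rewrite !mul0r.
  by rewrite exprS mulKf.
have d2 : N%:R * N.-1%:R * t ^+ N.-1.-1 = N%:R * (N%:R - 1) * (t^-1 * T).
  rewrite /T; case: (N) => [|[|N']]; rewrite ?mul0r ?subrr ?mulr0 ?mul0r//.
  have -> : N'.+2%:R - 1 = N'.+1%:R :> R by rewrite -natr1 addrK.
  by rewrite /= !exprS !mulKf.
have k1 : k%:R * t ^+ (mdeg a + k.-1) = k%:R * T.
  rewrite /T /N; case: (k) => [|k']; first by rewrite !mul0r.
  by rewrite addnS exprS mulKf.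
have s1 : \sum_(i < d) (a i * (a i).-1)%:R *
    (t ^+ (mdeg (drop2 a i) + k.+1) * mono (drop2 a i) xi) =
    T * \sum_(i < d) (a i * (a i).-1)%:R * mono (drop2 a i) xi.
  rewrite mulr_sumr; apply: eq_bigr => i _.
  case: (ltnP 1 (a i)) => [ai|]; last first.
    by case: (a i) => [|[|]]// _; rewrite muln0 !mul0r mulr0.
  rewrite mulrCA; congr (_ * _).
  by rewrite /T /N -(mdeg_drop2 ai) addSn exprS mulKf//; congr (_ ^+ _); lia.
rewrite s1; set S := \sum_(i < d) _.
set m := mono a xi; set x := (mdeg a)%:R; set K := k%:R; set D := d%:R.
have NE : N%:R = x + K by rewrite /N natrD.
transitivity (z * (t * (1 + t) * m * (N%:R * N.-1%:R * t ^+ N.-1.-1)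
  + (D - 1 + (- p + D + 1) * t) * m * (N%:R * t ^+ N.-1)
  + t^-1 * t ^+ N * (S - x * (x + D - 2) * m) - lam * m * t ^+ N)).
  ring.
transitivity (z * ((N%:R * (N%:R + D - p) - lam) * t ^+ N * m
  + K * t ^+ (mdeg a + k.-1) * (2 * x + K + D - 2) * m + T * S)); last by ring.
rewrite d2 d1 k1 -/T TE NE; field.
exact: t0.
Qed.
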